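(* For $i\in\{1,2,3\}$, let $W_i$ (and $W$) be marked weighted graphs, $G_i$ (and $G$) be marked elastic graphs, and $K_i$ (and $K$) be marked length graphs. Given marked PL maps between these spaces as specified on each line, the given inequality holds: 1. $W_1\xrightarrow{\phi}W_2\xrightarrow{\psi}W_3$: $\ \mathrm{WR}(\psi\circ\phi)\le\mathrm{WR}(\phi)\,\mathrm{WR}(\psi)$. 2. $W_1\xrightarrow{\phi}W_2\xrightarrow{c}G$: $\ \mathrm{EL}(c\circ\phi)\le\mathrm{WR}(\phi)^2\,\mathrm{EL}(c)$. 3. $W_1\xrightarrow{\phi}W_2\xrightarrow{f}K$: $\ \ell(f\circ\phi)\le\mathrm{WR}(\phi)\,\ell(f)$. 4. $W\xrightarrow{c}G_1\xrightarrow{\phi}G_2$: $\ \mathrm{EL}(\phi\circ c)\le\mathrm{EL}(c)\,\mathrm{Emb}(\phi)$. 5. $W\xrightarrow{c}G\xrightarrow{f}K$: $\ \ell(f\circ c)^2\le\mathrm{EL}(c)\,\mathrm{Dir}(f)$. 6. $W\xrightarrow{c}K_1\xrightarrow{\phi}K_2$: $\ \ell(\phi\circ c)\le\ell(c)\,\mathrm{Lip}(\phi)$. 7. $G_1\xrightarrow{\phi}G_2\xrightarrow{\psi}G_3$: $\ \mathrm{Emb}(\psi\circ\phi)\le\mathrm{Emb}(\phi)\,\mathrm{Emb}(\psi)$. 8. $G_1\xrightarrow{\phi}G_2\xrightarrow{f}K$: $\ \mathrm{Dir}(f\circ\phi)\le\mathrm{Emb}(\phi)\,\mathrm{Dir}(f)$.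 9. $G\xrightarrow{f}K_1\xrightarrow{\phi}K_2$: $\ \mathrm{Dir}(\phi\circ f)\le\mathrm{Dir}(f)\,\mathrm{Lip}(\phi)^2$. 10. $K_1\xrightarrow{\phi}K_2\xrightarrow{\psi}K_3$: $\ \mathrm{Lip}(\psi\circ\phi)\le\mathrm{Lip}(\phi)\,\mathrm{Lip}(\psi)$. Each inequality still holds if we take homotopy classes on both sides (i.e. replace the energy of each map by the energy of its homotopy class).
   Context: Graphs are finite 1-dimensional CW complexes with a linear structure on each edge; maps are continuous and piecewise-linear (PL) and need not send vertices to vertices. A marked graph has a finite (possibly empty) set of marked vertices; marked maps send marked points to marked points and homotopies are through marked maps. A weighted graph has a piecewise-constant weight function $w\ge0$. A length graph has a length $\ell(e)>0$ on each edge. An elastic graph has $\alpha(e)>0$ on each edge, treated as the length of $e$ for derivatives and integration. $|f'|$ is the absolute value of the derivative with respect to these metrics. Energies. For $c$ from a weighted graph and generic $y$ in the target, $n_c(y)=\sum_{x\in c^{-1}(y)}w(x)$. $\mathrm{WR}(\phi)=\operatorname{ess\,sup}_{y}n_\phi(y)/w(y)$ for $\phi$ between weighted graphs. $\mathrm{EL}(c)=\int_Gn_c(y)^2\,dy$ for $c\colon W\to G$. $\ell(f)=\int_Ww(x)|f'(x)|\,dx$ for $f\colon W\to K$. $\mathrm{Emb}(\phi)=\operatorname{ess\,sup}_{y\in G_2}\sum_{x\in\phi^{-1}(y)}|\phi'(x)|$ for $\phi\colon G_1\to G_2$. $\mathrm{Dir}(f)=\int_G|f'(x)|^2\,dx$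 for $f\colon G\to K$. $\mathrm{Lip}(\phi)=\operatorname{ess\,sup}|\phi'|$ for $\phi\colon K_1\to K_2$. The energy of a homotopy class is the infimum of the energies of the PL maps in it.
   Formalization: In items 1–3, since w≥0 allows WR(φ)=∞ while the other factor is 0, the undefined product ∞·0 is read as ∞ (no bound); with the value 0 the inequality fails, e.g. for φ the identity of an edge from weight 1 to weight 0. The product 0·∞ is read as 0. *)

(* Defs.v *)
From HB Require Import structures.
From mathcomp Require Import all_boot all_order all_algebra.
From mathcomp Require Import all_classical all_reals all_analysis.
From mathcomp Require Import ess_sup_inf.

Set Implicit Arguments.
Unset Strict Implicit.
Unset Printing Implicit Defensive.

Import Order.TTheory GRing.Theory Num.Theory.
Import numFieldNormedType.Exports.

Local Open Scope classical_set_scope.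
Local Open Scope ring_scope.

(* Loops, multiple edges, isolated vertices and disconnected graphs are allowed. *)
Record graph := Graph {
  vertex : finType;
  edge : finType;
  src : edge -> vertex;
  tgt : edge -> vertex }.

Record marked_graph := MarkedGraph {
  mg_graph :> graph;
  marked : {set vertex mg_graph} }.

(* The geometric realization: a point is a vertex, or lies in the interior of  *)
(* an edge, which is parametrized linearly by the open unit interval.          *)
Definition points (R : realType) (G : graph) : Type :=
  (vertex G + edge G * {t : R | 0 < t < 1})%type.

HB.instance Definition _ (R : realType) (G : graph) :=
  Choice.on (points R G).

(* The characteristic map [0, 1] -> G of the edge e, extended to R by          *)
(* composition with the retraction of R onto [0, 1].                           *)
Definition edge_pt (R : realType) (G : graph) (e : edge G) (t : R) :
    points R G :=
  if insub t is Some u then inr (e, u)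
  else if t <= 0 then inl (src e) else inl (tgt e).

(* The CW topology is the final topology of the characteristic maps (vertices  *)
(* being discrete). As [0, 1] is a retract of R, a subset of [0, 1] is         *)
(* relatively open iff its preimage under the retraction is open in R.         *)
Definition points_open (R : realType) (G : graph) : set (set (points R G)) :=
  [set U | forall e : edge G, open (@edge_pt R G e @^-1` U)].

Section points_topology.
Variables (R : realType) (G : graph).

Lemma points_openT : points_open [set: points R G].
Proof. by move=> e; rewrite preimage_setT; exact: openT. Qed.

Lemma points_openI : setI_closed (@points_open R G).
Proof. by move=> A B oA oB e; rewrite preimage_setI; exact: openI. Qed.

Lemma points_open_bigU (I : Type) (f : I -> set (points R G)) :
  (forall i, points_open (f i)) -> points_open (\bigcup_i f i).
Proof.
move=> of_ e; rewrite preimage_bigcup.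
by apply: bigcup_open => i _; exact: of_.
Qed.

HB.instance Definition _ := isOpenTopological.Build (points R G)
  points_openT points_openI points_open_bigU.

End points_topology.

Definition piecewise_constant (R : realType) (G : graph)
    (w : points R G -> R) : Prop :=
  forall e : edge G, exists s : seq R, itv_partition 0 1 s /\
    forall i, (i < size s)%N -> exists c : R,
      forall t, nth 0 (0 :: s) i < t < nth 0 s i -> w (edge_pt e t) = c.

Record weighted_graph (R : realType) := WeightedGraph {
  wg_graph :> marked_graph;
  weight : points R wg_graph -> R;
  weight_ge0 : forall x, 0 <= weight x;
  weight_pc : piecewise_constant weight }.

Record length_graph (R : realType) := LengthGraph {
  lg_graph :> marked_graph;
  elength : edge lg_graph -> R;
  elength_gt0 : forall e, 0 < elength e }.

Record elastic_graph (R : realType) := ElasticGraph {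
  eg_graph :> marked_graph;
  elastic : edge eg_graph -> R;
  elastic_gt0 : forall e, 0 < elastic e }.

(* Vertices of G2 need not be hit by vertices of G1: each edge of G1 may be    *)
(* subdivided so that every piece is constant or affine into one closed edge.  *)
(* The constant case is only needed for isolated vertices of G2.               *)
Definition piecewise_linear (R : realType) (G1 G2 : graph)
    (f : points R G1 -> points R G2) : Prop :=
  forall e : edge G1, exists s : seq R, itv_partition 0 1 s /\
    forall i, (i < size s)%N ->
      let piece := `[nth 0 (0 :: s) i, nth 0 s i]%R in
      (exists y, forall t, t \in piece -> f (edge_pt e t) = y) \/
      (exists (e' : edge G2) (p q : R), forall t, t \in piece ->
        0 <= p * t + q <= 1 /\ f (edge_pt e t) = edge_pt e' (p * t + q)).

Definition marked_points (R : realType) (G : marked_graph) :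
    set (points R G) :=
  [set inl v | v in [set` marked G]].
Arguments marked_points : clear implicits.

Definition is_marked (R : realType) (G1 G2 : marked_graph)
    (f : points R G1 -> points R G2) : Prop :=
  f @` marked_points R G1 `<=` marked_points R G2.

Definition marked_PL (R : realType) (G1 G2 : marked_graph)
    (f : points R G1 -> points R G2) : Prop :=
  [/\ continuous f, piecewise_linear f & is_marked f].

Definition homotopic (R : realType) (G1 G2 : marked_graph)
    (f g : points R G1 -> points R G2) : Prop :=
  exists H : points R G1 * R -> points R G2,
    [/\ {within [set p | 0 <= p.2 <= 1], continuous H},
        forall x, H (x, 0) = f x,
        forall x, H (x, 1) = g x
      & forall t, 0 <= t <= 1 -> is_marked (fun x => H (x, t))].

Definition homotopy_class (R : realType) (G1 G2 : marked_graph)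
    (f : points R G1 -> points R G2) : set (points R G1 -> points R G2) :=
  [set g | marked_PL g /\ homotopic f g].

Definition edge_coord (R : realType) (G : graph) (e : edge G)
    (x : points R G) : R :=
  if x is inr (e', t) then (if e' == e then val t else 0) else 0.

(* |f'| for the metrics in which the edges have lengths l1 and l2. The value 0 *)
(* where x or f x is a vertex is a convention: x ranges there over a set on    *)
(* which f is locally constant, up to finitely many points. At the finitely    *)
(* many other break points of f the value is irrelevant.                       *)
Definition abs_deriv (R : realType) (G1 G2 : graph)
    (l1 : edge G1 -> R) (l2 : edge G2 -> R)
    (f : points R G1 -> points R G2) (x : points R G1) : R :=
  match x, f x with
  | inr (e, t), inr (e', _) =>
      `|derive1 (fun u : R => edge_coord e' (f (edge_pt e u))) (val t)|
        * (l2 e' / l1 e)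
  | _, _ => 0
  end.

Local Open Scope ereal_scope.

Section measure_theory.
Variables (R : realType) (G : graph).

Definition integral_graph (l : edge G -> R) (F : points R G -> \bar R) :
    \bar R :=
  \sum_(e : edge G)
    (l e)%:E * \int[@lebesgue_measure R]_(t in `]0%R, 1%R[) F (edge_pt e t).

(* Essential supremum in [0, +oo] with respect to the class of Lebesgue        *)
(* measure on each edge. The library's ess_sup is -oo for the zero measure,    *)
(* hence the explicit unit 0 for graphs without edges.                         *)
Definition ess_sup_graph (F : points R G -> \bar R) : \bar R :=
  \big[maxe/0]_(e : edge G)
    ess_sup (mrestr (@lebesgue_measure R) (measurable_itv `]0%R, 1%R[))
      (fun t => F (edge_pt e t)).

End measure_theory.

Section energies.
Variable R : realType.

Definition fiber_weight (W : weighted_graph R) (G : graph)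
    (c : points R W -> points R G) (y : points R G) : \bar R :=
  \esum_(x in c @^-1` [set y]) (weight x)%:E.

(* In \bar R, n / 0 = +oo for n > 0, and 0 / 0 = 0 * +oo = 0.                  *)
Definition WR (W1 W2 : weighted_graph R) (phi : points R W1 -> points R W2) :=
  ess_sup_graph (fun y => fiber_weight phi y / (weight y)%:E).

Definition EL (W : weighted_graph R) (G : elastic_graph R)
    (c : points R W -> points R G) :=
  integral_graph (@elastic R G) (fun y => fiber_weight c y ^+ 2).

(* The source carries no metric, but w |f'| dx does not depend on the choice   *)
(* of one: every edge is given length 1.                                       *)
Definition len (W : weighted_graph R) (K : length_graph R)
    (f : points R W -> points R K) :=
  integral_graph (fun _ => 1%R)
    (fun x => (weight x * abs_deriv (fun _ => 1) (@elength R K) f x)%:E).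

Definition Emb (G1 G2 : elastic_graph R) (phi : points R G1 -> points R G2) :=
  ess_sup_graph (fun y => \esum_(x in phi @^-1` [set y])
    (abs_deriv (@elastic R G1) (@elastic R G2) phi x)%:E).

Definition Dir (G : elastic_graph R) (K : length_graph R)
    (f : points R G -> points R K) :=
  integral_graph (@elastic R G)
    (fun x => (abs_deriv (@elastic R G) (@elength R K) f x ^+ 2)%:E).

Definition Lip (K1 K2 : length_graph R) (phi : points R K1 -> points R K2) :=
  ess_sup_graph
    (fun x => (abs_deriv (@elength R K1) (@elength R K2) phi x)%:E).

Definition class_energy (G1 G2 : marked_graph)
    (E : (points R G1 -> points R G2) -> \bar R)
    (f : points R G1 -> points R G2) : \bar R :=
  ereal_inf [set E g | g in homotopy_class f].

(* Multiplication on [0, +oo] with +oo * 0 = +oo, but 0 * +oo = 0. WR is the   *)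
(* only energy that can be infinite, and a bound by WR phi = +oo carries no    *)
(* information: if phi is the identity of an edge from weight 1 to weight 0    *)
(* and c that of the same edge with weight 0, then WR phi = +oo and EL c = 0,  *)
(* but EL (c \o phi) > 0.                                                      *)
Definition mul_top (x y : \bar R) : \bar R :=
  if x == +oo then +oo else x * y.

End energies.

(* Main.v *)
Require Import Defs.
From HB Require Import structures.
From mathcomp Require Import all_boot all_order all_algebra.
From mathcomp Require Import finmap.
From mathcomp Require Import all_classical all_reals all_analysis.
From mathcomp Require Import ess_sup_inf measurable_realfun.
From mathcomp Require Import ring lra.

(* The maps of a chain W -> X -> Y can be made simultaneously simplicial: after *)
(* cutting every graph into finitely many open intervals (cells), each cell is  *)
(* either collapsed to a break point or mapped affinely onto a cell. For f the  *)
(* resulting partial map on cells, n_c(j) is the sum of the weights over the    *)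
(* fibre of j, |phi'| on i is the ratio len (f i) / len i, and all energies are *)
(* finite sums or maxima over cells; the inequalities then follow from          *)
(* regrouping sums along fibres, together with Cauchy-Schwarz when Emb or Dir   *)
(* is compared with EL. For homotopy classes, composition respects homotopy and *)
(* one passes to infima, all energies but WR being finite.                      *)

(** The delicate point is to choose the cells consistently: breaks of the source must include the
    preimages of the breaks of the target, and breaks of the target must include the images of
    breaks of the source. [refine_cells] escapes the circle by fixing first the finitely many points
    where the source must be cut anyway, pushing these forward, and adding the preimages of the
    target breaks only at the end. Those preimages are finite in number because they are taken only
    where the map is affine and nonconstant. [common_cells3] chains this for two maps.

    [esum_fiber] and [abs_deriv_cell] then read off multiplicities and derivatives on cells, while
    [integral_graph_cells] and [ess_sup_graph_le] turn integrals and essential suprema into sums and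
    maxima. What remains is finite combinatorics: multiplicities push forward along composites
    ([fiber_sum_comp]) and slopes obey the chain rule ([oslope_comp]). The bounds by [WR] are
    monotonicity of the push-forward. For [EL] against [Emb], Cauchy-Schwarz is applied on each
    fibre; for [len] against [EL] and [Dir], it is applied over all cells at once. [Dir] against
    [Emb] is a regrouping, and the others follow from the chain rule or from a bound on each slope.

    For homotopy classes, nearly optimal representatives are composed and the error tends to 0
    ([class_energy_mul_ge]). The exceptional case is the product of an infimum 0 of [WR] with an
    infinite one, handled by [WR_small_eq0]. *)

Set Implicit Arguments.
Unset Strict Implicit.
Unset Printing Implicit Defensive.

Import Order.TTheory GRing.Theory Num.Theory.
Import numFieldNormedType.Exports.

Local Open Scope classical_set_scope.
Local Open Scope ring_scope.

(** * Cells of a graph *)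

Section realization.
Variables (R : realType) (G : graph).
Implicit Types (e : edge G) (t : R) (x : points R G).

Lemma edge_ptE e t (t01 : 0 < t < 1) :
  edge_pt e t = inr (e, exist _ t t01) :> points R G.
Proof. by rewrite /edge_pt insubT. Qed.

Lemma edge_pt0 e : edge_pt e 0 = inl (src e) :> points R G.
Proof. by rewrite /edge_pt insubF ?ltxx// lexx. Qed.

Lemma edge_pt1 e : edge_pt e 1 = inl (tgt e) :> points R G.
Proof. by rewrite /edge_pt insubF ?ltxx ?andbF// ler10. Qed.

Lemma edge_pt_inj e e' t t' : 0 < t < 1 ->
  edge_pt e t = edge_pt e' t' :> points R G -> e = e' /\ t = t'.
Proof.
move=> t01; rewrite edge_ptE /edge_pt.
case: insubP => [u _ <- [-> <-]//|_]; by case: ifP.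
Qed.

Definition vertices : set (points R G) := range inl.

Lemma finite_vertices : finite_set vertices.
Proof. exact/finite_image/finite_finset. Qed.

Lemma points_case x :
  vertices x \/ exists e t, 0 < t < 1 /\ x = edge_pt e t.
Proof.
case: x => [v|[e [t t01]]]; first by left; exists v.
by right; exists e, t; rewrite edge_ptE.
Qed.

(* (e, a, b) stands for the subinterval ]a, b[ of the edge e. *)
Definition cell := (edge G * R * R)%type.
Implicit Types (c : cell) (B T : set (points R G)).

Definition open_cell c : set (points R G) :=
  [set x | exists t, c.1.2 < t < c.2 /\ x = edge_pt c.1.1 t].

Definition avoids T c : Prop :=
  [/\ 0 <= c.1.2, c.1.2 < c.2, c.2 <= 1 &
      forall t, c.1.2 < t < c.2 -> ~ T (edge_pt c.1.1 t)].

(** When [breaks B] holds, these are the connected components of the complement of [B]. *)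
Definition cells B : set cell :=
  [set c | [/\ avoids B c, B (edge_pt c.1.1 c.1.2) & B (edge_pt c.1.1 c.2)]].

Definition breaks B : Prop := finite_set B /\ vertices `<=` B.

Lemma avoids_sub T T' c : T `<=` T' -> avoids T' c -> avoids T c.
Proof. by move=> TT' [? ? ? av]; split=> // t /av; apply: contra_not => /TT'. Qed.

Lemma avoids_itv T c t : avoids T c -> c.1.2 < t < c.2 -> 0 < t < 1.
Proof. by case=> *; lra. Qed.

Lemma open_cell_nbreak T c x : avoids T c -> open_cell c x -> ~ T x.
Proof. by move=> [_ _ _ av] [t [tc ->]]; exact: av. Qed.

Lemma mid_cell T c : avoids T c -> exists2 t, c.1.2 < t < c.2 & 0 < t < 1.
Proof.
move=> [? ? ? _]; exists ((c.1.2 + c.2) / 2); lra.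
Qed.

Definition coords T e : set R := [set t | 0 <= t <= 1 /\ T (edge_pt e t)].

Lemma finite_coords T e : finite_set T -> finite_set (coords T e).
Proof.
(* [co] reads off the coordinate of an interior point, so only 0 and 1 escape its image. *)
move=> fT; pose co x : R := if x is inr (_, u) then val u else 0.
apply: (@sub_finite_set _ _ ([set 0; 1] `|` (co @` T))); last first.
  by rewrite finite_setU; split; [exact: finite_set2|exact: finite_image].
move=> t [t01 Tt].
have [->|t0] := eqVneq t 0; first by left; left.
have [->|t1] := eqVneq t 1; first by left; right.
right; exists (edge_pt e t) => //.
have h : 0 < t < 1 by lra.
by rewrite edge_ptE /=.
Qed.

Lemma finite_cells B : finite_set B -> finite_set (cells B).
Proof.
move=> fB; apply: (@sub_finite_set _ _ (\bigcup_(e in [set: edge G])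
    (([set e] `*` coords B e) `*` coords B e))).
  move=> [[e a] b] [[/= a0 ab b1 _] Ba Bb]; exists e => //.
  by split=> /=; [split=> //; split=> //; lra | split=> //; lra].
apply: bigcup_finite; first exact: finite_finset.
by move=> e _; do 2 ?[apply: finite_setX]; do ?[exact: finite_coords].
Qed.

Lemma finite_set_max (A : set R) : finite_set A -> A !=set0 ->
  exists2 m, A m & forall t, A t -> t <= m.
Proof.
move=> /finite_seqP[s ->] [t0 /= t0s].
exists (\big[Num.max/t0]_(u <- s) u) => /=.
  rewrite big_seq; elim/big_ind : _ => //= a b ? ?.
  by rewrite /Num.max; case: ifP.
by move=> t /= ts; exact: le_bigmax_seq.
Qed.

Lemma finite_set_min (A : set R) : finite_set A -> A !=set0 ->
  exists2 m, A m & forall t, A t -> m <= t.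
Proof.
move=> fA [t0 At0]; have [||m [u Au <-] umax] := @finite_set_max (-%R @` A).
- exact: finite_image.
- by exists (- t0), t0.
by exists u => // t At; rewrite -lerN2; apply: umax; exists t.
Qed.

(** The cell around a point ends at the nearest break coordinates on either side. These exist
    because the ends of every edge are breaks and there are finitely many breaks. *)
Lemma cell_cover B x : breaks B -> ~ B x ->
  exists2 c, cells B c & open_cell c x.
Proof.
move=> [fB vB] Bx; have [/vB//|[e [t [t01 xE]]]] := points_case x; subst x.
have [||a [[a01 Ba] at_] amax] := @finite_set_max (coords B e `&` [set u | u <= t]).
- exact/finite_setIl/finite_coords.
- by exists 0; split=> /=; [split; [lra|rewrite edge_pt0; apply: vB; exists (src e)]|lra].
have [||b [[b01 Bb] bt] bmin] := @finite_set_min (coords B e `&` [set u | t <= u]).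
- exact/finite_setIl/finite_coords.
- by exists 1; split=> /=; [split; [lra|rewrite edge_pt1; apply: vB; exists (tgt e)]|lra].
have at' : a < t.
  by rewrite lt_neqAle at_ andbT; apply/eqP => E; apply: Bx; rewrite -E.
have bt' : t < b.
  by rewrite lt_neqAle bt andbT; apply/eqP => E; apply: Bx; rewrite E.
exists (e, a, b); last by exists t => /=; rewrite at' bt'.
split=> //; split=> /=; try lra.
move=> u uab Bu; have [ut|tu] := leP u t.
  have : u <= a by apply: amax; split=> //; split=> //; lra.
  lra.
have : b <= u by apply: bmin; split=> //=; [split=> //; lra|lra].
lra.
Qed.

(** Otherwise an endpoint of [c'], which is a break, would lie inside [c]. *)
Lemma cell_sub B c c' t : avoids B c -> cells B c' ->
  c.1.1 = c'.1.1 -> c.1.2 < t < c.2 -> c'.1.2 < t < c'.2 ->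
  c'.1.2 <= c.1.2 /\ c.2 <= c'.2.
Proof.
case: c c' => [[e a] b] [[e' a'] b'] [/= ? ? ? av] [[/= ? ? ? _] Ba Bb] ee'; subst e'.
move=> tc tc'; split; rewrite leNgt; apply/negP => h.
  by apply: (av a') => //; lra.
by apply: (av b') => //; lra.
Qed.

Lemma open_cellE B c e t : avoids B c -> open_cell c (edge_pt e t) ->
  e = c.1.1 /\ c.1.2 < t < c.2.
Proof.
move=> av [u [uc /esym /edge_pt_inj[|<- <-]//]].
exact: avoids_itv av uc.
Qed.

Lemma cell_disj B c c' x : cells B c -> cells B c' ->
  open_cell c x -> open_cell c' x -> c = c'.
Proof.
move=> cB cB' [t [tc ->]] /open_cellE; case/(_ B); first by case: cB'.
move=> ee' tc'.
have [] := cell_sub (let: And3 h _ _ := cB in h) cB' ee' tc tc'.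
have [] := cell_sub (let: And3 h _ _ := cB' in h) cB (esym ee') tc' tc.
case: c c' ee' {cB cB' tc tc'} => [[e a] b] [[e' a'] b'] /= -> *.
by congr (_, _, _); lra.
Qed.

(** A finite type to index sums. [fset_set] has the intended elements only for a finite set, whence
    the hypotheses [breaks B] below. *)
Definition cellT B := fset_set (cells B).

Lemma cellTP B (c : cellT B) : breaks B -> cells B (val c).
Proof.
by case=> fB _; have := valP c; rewrite in_fset_set ?inE//; exact: finite_cells.
Qed.

Lemma cellT_ex B c : breaks B -> cells B c -> exists c' : cellT B, val c' = c.
Proof.
move=> [fB _] cB; have h : c \in cellT B.
  by rewrite /cellT in_fset_set ?inE//; exact: finite_cells.
by exists [` h]%fset.
Qed.

Lemma cellT_cover B x : breaks B -> ~ B x ->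
  exists c : cellT B, open_cell (val c) x.
Proof.
move=> bB Bx; have [c cB cx] := cell_cover bB Bx.
by have [c' c'E] := cellT_ex bB cB; exists c'; rewrite c'E.
Qed.

Lemma cellT_disj B (c c' : cellT B) x : breaks B ->
  open_cell (val c) x -> open_cell (val c') x -> c = c'.
Proof.
by move=> bB cx cx'; apply/val_inj/(cell_disj _ _ cx cx'); exact: cellTP.
Qed.

End realization.
Arguments vertices : clear implicits.

(** * Piecewise-linear maps and cellular maps *)

Lemma itv_partition_piece (R : realType) (x y a b : R) (s : seq R) :
  itv_partition x y s -> x <= a -> a < b -> b <= y ->
  (forall t, t \in s -> ~ (a < t < b)) ->
  exists i, [/\ (i < size s)%N, nth 0 (x :: s) i <= a & b <= nth 0 s i].
Proof.
elim: s x => [|h s ih] x xsy xa ab b_y nab.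
  by have /itv_partition_nil xy := xsy; lra.
have [bh|hb] := leP b h; first by exists 0%N.
have ha : h <= a.
  rewrite leNgt; apply/negP => ah; apply: (nab h); first exact: mem_head.
  by rewrite ah hb.
have [|t ts|i [i_s ia bi]] := ih h _ ha ab b_y.
- exact: itv_partition_cons xsy.
- by apply: nab; rewrite inE ts orbT.
by exists i.+1.
Qed.

Lemma affine_interior (R : realType) (a b p q t : R) : p != 0 ->
  0 <= p * a + q <= 1 -> 0 <= p * b + q <= 1 -> a < t < b ->
  0 < p * t + q < 1.
Proof.
move=> p0 Ha Hb /andP[a_t tb]; case: (ltgtP p 0) p0 => [p0 _|p0 _|//].
  have : p * t < p * a by rewrite ltr_nM2l.
  have : p * b < p * t by rewrite ltr_nM2l.
  lra.
have : p * a < p * t by rewrite ltr_pM2l.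
have : p * t < p * b by rewrite ltr_pM2l.
lra.
Qed.

Section edge_points.
Variables (R : realType) (G : graph).
Implicit Types (s : edge G -> seq R) (c : cell R G).

Definition edge_pts s : set (points R G) :=
  \bigcup_(e in [set: edge G]) (@edge_pt R G e @` [set` s e]).

Lemma finite_edge_pts s :
  finite_set (edge_pts s).
Proof.
apply: bigcup_finite; first exact: finite_finset.
by move=> e _; apply: finite_image.
Qed.

Lemma avoids_edge_pts s c :
  (forall e, itv_partition 0 1 (s e)) -> avoids (edge_pts s) c ->
  exists i, [/\ (i < size (s c.1.1))%N, nth 0 (0 :: s c.1.1) i <= c.1.2 &
    c.2 <= nth 0 (s c.1.1) i].
Proof.
move=> sP [a0 ab b1 av]; apply: (itv_partition_piece (sP _)) => // t ts /av; apply.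
by exists c.1.1 => //; exists t.
Qed.

Lemma piecewise_constant_cst (w : points R G -> R) :
  piecewise_constant w ->
  exists2 T, finite_set T &
    forall c, avoids T c -> exists v, forall x, open_cell c x -> w x = v.
Proof.
move=> /choice[s sP]; exists (edge_pts s); first exact: finite_edge_pts.
move=> c av; have [|i [i_s ia bi]] := avoids_edge_pts _ av.
  by move=> e; case: (sP e).
have [v vP] := (sP c.1.1).2 i i_s.
by exists v => x [t [tc ->]]; apply: vP; lra.
Qed.

End edge_points.

Section maps.
Variables (R : realType) (G1 G2 : graph).
Implicit Types (phi : points R G1 -> points R G2).
Implicit Types (c : cell R G1).

Definition const_on phi c y : Prop :=
  forall t, c.1.2 <= t <= c.2 -> phi (edge_pt c.1.1 t) = y.

Definition affine_on phi c (e' : edge G2) (p q : R) : Prop :=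
  p != 0 /\ forall t, c.1.2 <= t <= c.2 ->
    0 <= p * t + q <= 1 /\ phi (edge_pt c.1.1 t) = edge_pt e' (p * t + q).

Definition pl_on phi c : Prop :=
  (exists y, const_on phi c y) \/ (exists e' p q, affine_on phi c e' p q).

Lemma piecewise_linear_pl_on phi : piecewise_linear phi ->
  exists2 T, finite_set T & forall c, avoids T c -> pl_on phi c.
Proof.
move=> /choice[s sP]; exists (edge_pts s); first exact: finite_edge_pts.
move=> c av; have [|i [i_s ia bi]] := avoids_edge_pts _ av.
  by move=> e; case: (sP e).
have sub t : c.1.2 <= t <= c.2 ->
    t \in `[nth 0 (0 :: s c.1.1) i, nth 0 (s c.1.1) i].
  by rewrite in_itv /= => ?; lra.
have [[y yP]|[e' [p [q pqP]]]] := (sP c.1.1).2 i i_s.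
  by left; exists y => t /sub; exact: yP.
(* Affine pieces of slope 0 are filed under constants, so that the remaining ones are injective. *)
have [p0|p0] := eqVneq p 0.
  left; exists (edge_pt e' q) => t /sub /pqP[_].
  by rewrite p0 mul0r add0r.
by right; exists e', p, q; split => // t /sub; exact: pqP.
Qed.

(** The third clause ranges over all real [t], so that points of [c'] can be pulled back into [c].
    As cells have positive length, the last clause forces [p] to be nonzero. *)
Definition affine_onto phi c (c' : cell R G2) (p q : R) : Prop :=
  [/\ forall t, c.1.2 <= t <= c.2 ->
        phi (edge_pt c.1.1 t) = edge_pt c'.1.1 (p * t + q),
      forall t, c.1.2 <= t <= c.2 -> c'.1.2 <= p * t + q <= c'.2,
      forall t, (c.1.2 < t < c.2) = (c'.1.2 < p * t + q < c'.2) &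
      `|p| * (c.2 - c.1.2) = c'.2 - c'.1.2].

(* [f c = None] encodes that [phi] is constant on the cell [c]. *)
Definition cellular B1 B2 phi (f : cellT B1 -> option (cellT B2)) : Prop :=
  (forall x, B1 x -> B2 (phi x)) /\
  forall c : cellT B1, if f c is Some c' then exists p q, affine_onto phi (val c) (val c') p q
            else exists y, const_on phi (val c) y.

(** The endpoints of [c] go to breaks and its interior meets none, so the image interval is exactly
    one cell. A negative [p] exchanges the endpoints. *)
Lemma affine_on_affine_onto phi B1 B2 c e' p q :
  (forall x, B1 x -> B2 (phi x)) -> cells B1 c ->
  (forall x, open_cell c x -> ~ B2 (phi x)) ->
  affine_on phi c e' p q ->
  exists2 c', cells B2 c' & affine_onto phi c c' p q.
Proof.
move=> B12 [[a0 ab b1 _] Ba Bb] nB2 [p0 pq].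
set a' := p * c.1.2 + q; set b' := p * c.2 + q.
have aE : B2 (edge_pt e' a').
  by rewrite -(pq _ _).2 ?lexx ?(ltW ab)//; exact: B12.
have bE : B2 (edge_pt e' b').
  by rewrite -(pq _ _).2 ?lexx ?(ltW ab)//; exact: B12.
have [a'01 b'01] : 0 <= a' <= 1 /\ 0 <= b' <= 1.
  by split; apply: (pq _ _).1; rewrite ?lexx ?(ltW ab).
have inv t : p * ((t - q) / p) + q = t by field.
case: (ltgtP p 0) p0 => [p0 _|p0 _|//].
- have H t : (c.1.2 < t < c.2) = (b' < p * t + q < a').
    by rewrite /a' /b' !ltrD2r !ltr_nM2l// andbC.
  exists (e', b', a'); rewrite /cells /avoids/=; split=> //=.
  + split=> //; [lra|by rewrite /a' /b' ltrD2r ltr_nM2l|lra|].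
    move=> t; rewrite -[t]inv -H => tc.
    rewrite -(pq _ _).2; last lra.
    by apply: nB2; exists ((t - q) / p).
  + by move=> t tc; apply: (pq _ _).2.
  + by move=> t /andP[ta tb]; rewrite /a' /b' !lerD2r !ler_nM2l// ta tb.
  + by rewrite ltr0_norm// /a' /b'; ring.
- have H t : (c.1.2 < t < c.2) = (a' < p * t + q < b').
    by rewrite /a' /b' !ltrD2r !ltr_pM2l.
  exists (e', a', b'); rewrite /cells /avoids/=; split=> //=.
  + split=> //; [lra|by rewrite /a' /b' ltrD2r ltr_pM2l|lra|].
    move=> t; rewrite -[t]inv -H => tc.
    rewrite -(pq _ _).2; last lra.
    by apply: nB2; exists ((t - q) / p).
  + by move=> t tc; apply: (pq _ _).2.
  + by move=> t /andP[ta tb]; rewrite /a' /b' !lerD2r !ler_pM2l// ta tb.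
  + by rewrite gtr0_norm// /a' /b'; ring.
Qed.

Lemma finite_inj_preimage (T U : Type) (A : set T) (B : set U) (f : T -> U) :
  {in A &, injective f} -> finite_set B -> finite_set (A `&` f @^-1` B).
Proof.
move=> finj fB; have finj' : {in A `&` f @^-1` B &, injective f}.
  by move=> x y; rewrite !inE => -[Ax _] [Ay _]; apply: finj; rewrite inE.
rewrite -(eq_finite_set (inj_card_eq finj')).
by apply: sub_finite_set fB => _ [x [_ Bx] <-].
Qed.

(** The order of the quantifiers is the point: [T1] is chosen before [B2], so its image can be put
    into [B2], and [B1] is completed only afterwards by pulling [B2] back. *)
Lemma refine_cells phi T : piecewise_linear phi -> finite_set T ->
  exists T1, [/\ finite_set T1, T `<=` T1 &
    forall B2, breaks B2 -> phi @` T1 `<=` B2 ->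
      exists B1 (f : cellT B1 -> option (cellT B2)),
        [/\ breaks B1, T1 `<=` B1 & cellular phi f]].
Proof.
move=> /piecewise_linear_pl_on[Tphi fTphi Tphi_pl] fT.
pose T1 := T `|` Tphi `|` vertices R G1.
have fT1 : finite_set T1 by rewrite !finite_setU; do !split => //; exact: finite_vertices.
have bT1 : breaks T1 by split=> // x; right.
exists T1; split=> // [x ?|B2 bB2 T1B2]; first by left; left.
(* Preimages are added only inside cells where the map is affine with nonzero slope, hence
   injective. A collapsed cell with value in [B2] would contribute a whole interval. *)
pose N := \bigcup_(c in cells T1)
  ([set x | open_cell c x /\ exists e' p q, affine_on phi c e' p q] `&` phi @^-1` B2).
pose B1 := T1 `|` N.
have bB1 : breaks B1.
  split; last by move=> x vx; left; exact: bT1.2.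
  rewrite finite_setU; split=> //; apply: bigcup_finite; first exact: finite_cells.
  move=> c [[c0 cc c1 _] _ _]; apply: finite_inj_preimage; last by case: bB2.
  move=> x y; rewrite !inE => -[[t [tc ->]] [e' [p [q [p0 pq]]]]] [[u [uc ->]] _].
  rewrite (pq t _).2 ?(pq u _).2; [|lra|lra].
  have Ht : (0 < p * t + q < 1).
    by apply: affine_interior p0 _ _ tc; apply: (pq _ _).1; lra.
  move=> /(edge_pt_inj Ht)[_ /addIr /(mulfI p0) ->//].
have B12 x : B1 x -> B2 (phi x).
  by move=> [Tx|[c _ []//]]; apply: T1B2; exists x.
have fP (c : cellT B1) : exists o : option (cellT B2),
    if o is Some c' then exists p q, affine_onto phi (val c) (val c') p q
    else exists y, const_on phi (val c) y.
  have cB := cellTP c bB1; have [cav _ _] := cB.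
  have avT : avoids T1 (val c) by apply: avoids_sub cav => x; left.
  have [|[y yP]|[e' [p [q pq]]]] := Tphi_pl (val c).
  - by apply: avoids_sub cav => x ?; left; left; right.
  - by exists None, y.
  have nB2 x : open_cell (val c) x -> ~ B2 (phi x).
    move=> cx B2x; apply: (open_cell_nbreak cav cx); right.
    have [c0 c0T c0x] := cell_cover bT1 (open_cell_nbreak avT cx).
    exists c0 => //; split=> //; split=> //.
    have [//|[y yP]|//] := Tphi_pl c0.
      by case: c0T => av _ _; apply: avoids_sub av => z ?; left; right.
    (* Here [phi] would be constant on the cell [c0] of [T1], which contains the cell [val c] on
       which it is injective; the points [t] and [s] of the latter give the contradiction. *)
    exfalso.
    have [t [tc xE]] := cx; have [u [uc0 xE']] := c0x.
    have [ee tu] := edge_pt_inj (avoids_itv cav tc) (etrans (esym xE) xE').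
    subst u; have [l r] := cell_sub avT c0T ee tc uc0.
    have [_ cab _ _] := cav; have [p0 pqP] := pq.
    pose s := ((val c).1.2 + t) / 2.
    have Ht : 0 < p * t + q < 1.
      by apply: affine_interior p0 _ _ tc; apply: (pqP _ _).1; lra.
    have : edge_pt e' (p * t + q) = edge_pt e' (p * s + q).
      by rewrite -(pqP t _).2 -?(pqP s _).2 ?ee ?yP//; rewrite /s; lra.
    move=> /(edge_pt_inj Ht)[_ /addIr /(mulfI p0)]; rewrite /s; lra.
  have [c' c'B pqc] := affine_on_affine_onto B12 cB nB2 pq.
  have [c'' c''E] := cellT_ex bB2 c'B.
  by exists (Some c''), p, q; rewrite c''E.
have [f ff] := choice fP.
by exists B1, f; split=> // x; left.
Qed.

(** Serves to show that composites are piecewise linear, since cellular maps visibly compose. On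
    each edge, consecutive breaks in increasing order bound a cell. *)
Lemma cellular_piecewise_linear B1 B2 phi (f : cellT B1 -> option (cellT B2)) :
  breaks B1 -> breaks B2 -> cellular phi f -> piecewise_linear phi.
Proof.
move=> bB1 bB2 [_ ff] e.
have [fB vB] := bB1.
have [s sE] := (finite_seqP _).1 (finite_coords e fB).
have sP t : (t \in s) = `[< coords B1 e t >].
  by apply/idP/asboolP; rewrite sE.
have s0 : 0 \in s.
  by rewrite sP; apply/asboolP; split; [rewrite lexx ler01|rewrite edge_pt0; apply: vB; exists (src e)].
have s1 : 1 \in s.
  by rewrite sP; apply/asboolP; split; [rewrite lexx ler01|rewrite edge_pt1; apply: vB; exists (tgt e)].
pose r := sort <=%R (undup s).
have rs t : (t \in r) = (t \in s) by rewrite mem_sort mem_undup.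
have r_sorted : sorted <%R r.
  by rewrite lt_sorted_uniq_le sort_uniq undup_uniq sort_le_sorted.
have rE : r = 0 :: behead r.
  case: r rs r_sorted => [/(_ 0)|h r' rs /=]; first by rewrite s0.
  rewrite path_sortedE; last exact: lt_trans.
  move=> /andP[/allP hr _]; congr cons.
  have := rs 0; rewrite s0 inE => /orP[/eqP->//|/hr h0].
  have := rs h; rewrite mem_head sP => /esym/asboolP[]; lra.
have nth_rs i : (i < size r)%N -> coords B1 e (nth 0 r i).
  by move=> ir; apply/asboolP; rewrite -sP -rs mem_nth.
have nth_lt i j : (i < size r)%N -> (j < size r)%N ->
  (nth 0 r i < nth 0 r j) = (i < j)%N by move=> ? ?; rewrite lt_sorted_ltn_nth.
have size_r : size r = (size (behead r)).+1 by rewrite {1}rE.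
(* [itv_partition 0 1] lists the subdivision points without the left endpoint 0, which is the head
   of [r]. *)
exists (behead r); split.
  split; first by move: r_sorted; rewrite rE.
  have lastE : last 0 (behead r) = nth 0 r (size r).-1.
    by rewrite (last_nth 0) -rE size_r.
  rewrite lastE; apply/eqP/le_anti.
  have [/andP[_ ->] _] := nth_rs (size r).-1 ltac:(by rewrite size_r).
  rewrite leNgt; apply/negP.
  have /(nthP 0)[k kr <-] : 1 \in r by rewrite rs.
  rewrite nth_lt//; last by rewrite size_r.
  by move: kr; rewrite size_r /= ltnS leqNgt => /negP.
move=> i ib piece.
have cB : exists c : cellT B1, val c = (e, nth 0 (0 :: behead r) i, nth 0 (behead r) i).
  apply: cellT_ex => //; rewrite -rE nth_behead.
  have [i1 i2] : (i < size r)%N /\ (i.+1 < size r)%N by rewrite size_r ltnS ltnW.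
  have [[i01 Bi] [j01 Bj]] := (nth_rs _ i1, nth_rs _ i2).
  have ij : nth 0 r i < nth 0 r i.+1 by rewrite nth_lt.
  rewrite /cells /avoids /=; split=> //; split=> //; [lra|lra|].
  move=> t tij Bt; have : t \in r by rewrite rs sP; apply/asboolP; split=> //; lra.
  move=> /(nthP 0)[k kr kt]; move: tij; rewrite -kt !nth_lt// => /andP[ik ki].
  by move: ik; rewrite ltnNge -ltnS ki.
have [c cE] := cB; have := ff c.
case: (f c) => [c' [p [q [H1 H2 _ _]]]|[y yP]].
  right; exists (val c').1.1, p, q => t tp.
  have tc : (val c).1.2 <= t <= (val c).2 by rewrite cE; move: tp; rewrite /piece in_itv.
  have [[? ? ? _] _ _] := cellTP c' bB2.
  split; first by have := H2 t tc; lra.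
  by rewrite -H1// cE.
left; exists y => t tp; have := yP t; rewrite cE/=; apply.
by move: tp; rewrite /piece in_itv.
Qed.

End maps.

(** * Sums over the fibres of a partial map *)

(** With A the sum of the [y i ^+ 2 / l i] and B the left sum, expanding the nonnegative sum of
    [l i * (A * x i - B * (y i / l i)) ^+ 2] gives A times the difference of the two sides; if A =
    0, all [y i] vanish. *)
Lemma sum_cauchy_schwarz (R : realFieldType) (I : finType) (P : pred I) (l x y : I -> R) :
  (forall i, 0 < l i) ->
  (\sum_(i | P i) x i * y i) ^+ 2 <=
  (\sum_(i | P i) l i * x i ^+ 2) * (\sum_(i | P i) y i ^+ 2 / l i).
Proof.
move=> l0; set B := \sum_(i | P i) _; set C := \sum_(i | P i) _.
set A := \sum_(i | P i) _.
have t0 i : P i -> 0 <= y i ^+ 2 / l i.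
  by move=> _; rewrite divr_ge0 ?sqr_ge0 ?ltW.
have : 0 <= A by exact: sumr_ge0.
rewrite le_eqVlt => /predU1P[/esym/eqP A0|A0].
  have y0 i : P i -> y i = 0.
    move=> Pi; move: A0; rewrite psumr_eq0// => /allP/(_ i (mem_index_enum i)).
    by rewrite Pi/= mulf_eq0 invr_eq0 (gt_eqF (l0 i)) orbF sqrf_eq0 => /eqP.
  rewrite /B big1 ?expr0n/=; last by move=> i /y0 ->; rewrite mulr0.
  by rewrite (eqP A0) mulr0.
have sq a b : \sum_(i | P i) l i * (a * x i - b * (y i / l i)) ^+ 2 =
    a ^+ 2 * C - 2 * a * b * B + b ^+ 2 * A.
  rewrite !mulr_sumr -sumrB -big_split/=.
  by apply: eq_bigr => i _; have := l0 i => li; field; rewrite gt_eqF.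
have : 0 <= \sum_(i | P i) l i * (A * x i - B * (y i / l i)) ^+ 2.
  by apply: sumr_ge0 => i _; rewrite mulr_ge0 ?sqr_ge0 ?ltW.
rewrite sq (_ : _ + _ = A * (C * A - B ^+ 2)); last by ring.
by rewrite pmulr_rge0// subr_ge0.
Qed.

Section partial_maps.
Variable R : realFieldType.
Implicit Types C : finType.

(** The multiplicity n_c on cells, or the push-forward of [w] along the partial map [f]. *)
Definition fiber_sum C1 C2 (f : C1 -> option C2) (w : C1 -> R) c2 : R :=
  \sum_(c1 | f c1 == Some c2) w c1.

(** The absolute derivative on cells; a collapsed cell has derivative 0. *)
Definition oslope C1 C2 (l1 : C1 -> R) (l2 : C2 -> R) (f : C1 -> option C2) c1 : R :=
  if f c1 is Some c2 then l2 c2 / l1 c1 else 0.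

Lemma fiber_sum_ge0 C1 C2 (f : C1 -> option C2) w c2 :
  (forall c, 0 <= w c) -> 0 <= fiber_sum f w c2.
Proof. by move=> w0; exact: sumr_ge0. Qed.

Lemma ler_fiber_sum C1 C2 (f : C1 -> option C2) w w' c2 :
  (forall c, w c <= w' c) -> fiber_sum f w c2 <= fiber_sum f w' c2.
Proof. by move=> ww'; exact: ler_sum. Qed.

Lemma fiber_sumZ C1 C2 (f : C1 -> option C2) w k c2 :
  fiber_sum f (fun c => k * w c) c2 = k * fiber_sum f w c2.
Proof. by rewrite /fiber_sum mulr_sumr. Qed.

Lemma oslope_ge0 C1 C2 l1 l2 (f : C1 -> option C2) c :
  (forall c, 0 < l1 c) -> (forall c, 0 < l2 c) -> 0 <= oslope l1 l2 f c.
Proof.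
move=> l10 l20; rewrite /oslope; case: (f c) => // c2.
by rewrite divr_ge0// ltW.
Qed.

Lemma sum_fiber_sum C1 C2 (f : C1 -> option C2) (F : C1 -> C2 -> R) :
  \sum_c2 fiber_sum f (F ^~ c2) c2 =
  \sum_c1 if f c1 is Some c2 then F c1 c2 else 0.
Proof.
rewrite /fiber_sum (exchange_big_dep predT)//=; apply: eq_bigr => c1 _.
case: (f c1) => [c2|]; last by rewrite big_pred0_eq.
rewrite (bigD1 c2)//= big1 ?addr0// => c /andP[/eqP[->]].
by rewrite eqxx.
Qed.

(** Collapsed cells lie in no fibre, so their weight is lost on the left. *)
Lemma sum_fiber_sum_le C1 C2 (f : C1 -> option C2) (w : C1 -> R) :
  (forall c, 0 <= w c) -> \sum_c2 fiber_sum f w c2 <= \sum_c1 w c1.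
Proof.
move=> w0; rewrite (sum_fiber_sum f (fun c1 _ => w c1)).
by apply: ler_sum => c1 _; case: (f c1).
Qed.

(** * The inequalities for composites of partial maps of cells *)

Section composition.
Variables (C1 C2 C3 : finType) (f : C1 -> option C2) (g : C2 -> option C3).
Variables (l1 : C1 -> R) (l2 : C2 -> R) (l3 : C3 -> R) (w : C1 -> R).
Hypothesis l1_gt0 : forall c, 0 < l1 c.
Hypothesis l2_gt0 : forall c, 0 < l2 c.
Hypothesis l3_gt0 : forall c, 0 < l3 c.
Hypothesis w_ge0 : forall c, 0 <= w c.
Let h c := obind g (f c).
Let n := fiber_sum f w.

Lemma fiber_sum_comp (v : C1 -> R) c3 :
  fiber_sum h v c3 = fiber_sum g (fiber_sum f v) c3.
Proof.
rewrite /fiber_sum (exchange_big_dep predT)//= [LHS]big_mkcond.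
apply: eq_bigr => c1 _; rewrite /h; case: (f c1) => [c2|] /=; last first.
  by rewrite big1// => c /andP[].
case: ifP => [gc|gc].
  rewrite (big_pred1 c2)// => c /=; rewrite (inj_eq Some_inj) [c2 == c]eq_sym.
  by case: (eqVneq c c2) => [->|_]; rewrite ?gc ?andbF.
rewrite big1// => c /andP[gc' /eqP[E]].
by move: gc; rewrite E gc'.
Qed.

(** The chain rule. *)
Lemma oslope_comp c :
  oslope l1 l3 h c =
  oslope l1 l2 f c * (if f c is Some c2 then oslope l2 l3 g c2 else 0).
Proof.
rewrite /oslope /h; case: (f c) => [c2|] /=; last by rewrite mul0r.
case: (g c2) => [c3|]; last by rewrite mulr0.
by have := l1_gt0 c; have := l2_gt0 c2 => *; field; rewrite !gt_eqF.
Qed.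

(** Change of variables: the length of each target cell is the slope times the length of every cell
    above it. *)
Lemma sum_fiber_sum_len (v : C2 -> R) :
  \sum_c3 fiber_sum g v c3 * l3 c3 = \sum_c2 l2 c2 * (v c2 * oslope l2 l3 g c2).
Proof.
under eq_bigr do rewrite mulrC -fiber_sumZ.
rewrite (sum_fiber_sum g (fun c2 c3 => l3 c3 * v c2)); apply: eq_bigr => c2 _.
rewrite /oslope; case: (g c2) => [c3|]; last by rewrite !mulr0.
by have := l2_gt0 c2 => *; field; rewrite gt_eqF.
Qed.

Lemma fiber_sum_comp_le (w2 : C2 -> R) r c3 :
  (forall c2, n c2 <= r * w2 c2) ->
  fiber_sum h w c3 <= r * fiber_sum g w2 c3.
Proof.
by move=> nr; rewrite fiber_sum_comp -fiber_sumZ; exact: ler_fiber_sum.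
Qed.

(** On the fibre over [c3], Cauchy-Schwarz bounds the squared push-forward of [n] by the sum of
    [l2 * n ^+ 2] times the sum of [1 / l2]. Multiplied by [l3 c3], the second factor is the fibre
    sum of slopes, hence at most [E]. *)
Lemma sum_fiber_sum_sqr_comp_le E : 0 <= E -> (forall c3, fiber_sum g (oslope l2 l3 g) c3 <= E) ->
  \sum_c3 l3 c3 * fiber_sum h w c3 ^+ 2 <= (\sum_c2 l2 c2 * n c2 ^+ 2) * E.
Proof.
move=> E0 gE; apply: (@le_trans _ _ (\sum_c3 fiber_sum g (fun c2 => l2 c2 * n c2 ^+ 2) c3 * E)).
  apply: ler_sum => c3 _.
  apply: (@le_trans _ _ (fiber_sum g (fun c2 => l2 c2 * n c2 ^+ 2) c3 *
                         fiber_sum g (oslope l2 l3 g) c3)); last first.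
    apply: ler_wpM2l => //; apply: fiber_sum_ge0 => c.
    by rewrite mulr_ge0 ?sqr_ge0 ?ltW.
  have -> : fiber_sum g (oslope l2 l3 g) c3 =
      l3 c3 * \sum_(c2 | g c2 == Some c3) 1 ^+ 2 / l2 c2.
    rewrite mulr_sumr; apply: eq_bigr => c2 /eqP gc.
    by rewrite /oslope gc expr1n mul1r.
  rewrite [leRHS]mulrCA; apply: ler_wpM2l; first exact: ltW.
  rewrite (_ : fiber_sum h w c3 = \sum_(c2 | g c2 == Some c3) n c2 * 1).
    exact: sum_cauchy_schwarz.
  by rewrite fiber_sum_comp; apply: eq_bigr => c2 _; rewrite mulr1.
rewrite -mulr_suml; apply: ler_wpM2r => //.
by apply: sum_fiber_sum_le => c; rewrite mulr_ge0 ?sqr_ge0 ?ltW.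
Qed.

(** By change of variables the left sum becomes the sum of [l2 * n * oslope], to which
    Cauchy-Schwarz with weights [l2] applies. *)
Lemma sum_fiber_sum_comp_sqr_le :
  (\sum_c3 fiber_sum h w c3 * l3 c3) ^+ 2 <=
  (\sum_c2 l2 c2 * n c2 ^+ 2) * (\sum_c2 l2 c2 * oslope l2 l3 g c2 ^+ 2).
Proof.
under eq_bigr do rewrite fiber_sum_comp.
rewrite sum_fiber_sum_len.
under eq_bigr do rewrite mulrCA.
apply: le_trans (sum_cauchy_schwarz _ _ _ l2_gt0) _.
rewrite le_eqVlt; apply/orP; left; apply/eqP; congr (_ * _).
apply: eq_bigr => c _; have := l2_gt0 c => *; field; rewrite gt_eqF//.
Qed.

Lemma sum_fiber_sum_comp_le L : (forall c2, oslope l2 l3 g c2 <= L) ->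
  \sum_c3 fiber_sum h w c3 * l3 c3 <= (\sum_c2 n c2 * l2 c2) * L.
Proof.
move=> gL; under eq_bigr do rewrite fiber_sum_comp.
rewrite sum_fiber_sum_len mulr_suml; apply: ler_sum => c _.
rewrite mulrA [l2 c * _]mulrC; apply: ler_wpM2l => //.
by rewrite mulr_ge0 ?fiber_sum_ge0// ltW.
Qed.

(** By the chain rule the slope of [g] factors out of each fibre of [f]. *)
Lemma fiber_oslope_comp_le E c3 : (forall c2, fiber_sum f (oslope l1 l2 f) c2 <= E) ->
  fiber_sum h (oslope l1 l3 h) c3 <= E * fiber_sum g (oslope l2 l3 g) c3.
Proof.
move=> fE; rewrite fiber_sum_comp -fiber_sumZ; apply: ler_fiber_sum => c2.
rewrite [leLHS](_ : _ = oslope l2 l3 g c2 * fiber_sum f (oslope l1 l2 f) c2).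
  by rewrite mulrC; apply: ler_wpM2r => //; exact: oslope_ge0.
rewrite -fiber_sumZ; apply: eq_bigr => c1 /eqP fc.
by rewrite oslope_comp fc mulrC.
Qed.

(** One factor of the squared slope of [f] absorbs [l1]: on a cell over [c2], [l1] times the squared
    slope is [l2 c2] times the slope. Grouping by fibres of [f] then leaves the fibre sums of
    slopes, bounded by [E]. *)
Lemma sum_oslope_sqr_comp_le E : (forall c2, fiber_sum f (oslope l1 l2 f) c2 <= E) ->
  \sum_c1 l1 c1 * oslope l1 l3 h c1 ^+ 2 <=
  E * \sum_c2 l2 c2 * oslope l2 l3 g c2 ^+ 2.
Proof.
move=> fE.
rewrite [leLHS](_ : _ = \sum_c2 fiber_sum f (fun c1 => l2 c2 * oslope l2 l3 g c2 ^+ 2 *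
    oslope l1 l2 f c1) c2).
  rewrite mulr_sumr; apply: ler_sum => c2 _.
  rewrite fiber_sumZ mulrC; apply: ler_wpM2r => //.
  by rewrite mulr_ge0 ?sqr_ge0 ?ltW.
rewrite (sum_fiber_sum f (fun c1 c2 => l2 c2 * oslope l2 l3 g c2 ^+ 2 * oslope l1 l2 f c1)).
apply: eq_bigr => c1 _; rewrite oslope_comp; case fc: (f c1) => [c2|].
  have -> : oslope l1 l2 f c1 = l2 c2 / l1 c1 by rewrite /oslope fc.
  by have := l1_gt0 c1 => *; field; rewrite gt_eqF.
by rewrite mulr0 expr0n mulr0.
Qed.

Lemma oslope_comp_le L c : (forall c2, oslope l2 l3 g c2 <= L) -> 0 <= L ->
  oslope l1 l3 h c <= oslope l1 l2 f c * L.
Proof.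
move=> gL L0; rewrite oslope_comp; apply: ler_wpM2l; first exact: oslope_ge0.
by case: (f c).
Qed.

Lemma sum_oslope_sqr_comp_le_sqr L : (forall c2, oslope l2 l3 g c2 <= L) -> 0 <= L ->
  \sum_c1 l1 c1 * oslope l1 l3 h c1 ^+ 2 <=
  (\sum_c1 l1 c1 * oslope l1 l2 f c1 ^+ 2) * L ^+ 2.
Proof.
move=> gL L0; rewrite mulr_suml; apply: ler_sum => c _.
rewrite -mulrA; apply: ler_wpM2l; first exact: ltW.
rewrite -exprMn ler_sqr ?nnegrE ?oslope_comp_le//.
- apply: oslope_ge0 => //.
- by rewrite mulr_ge0// oslope_ge0.
Qed.

End composition.
End partial_maps.

(** * Fibres and derivatives of cellular maps *)

Section cellular_maps.
Variable R : realType.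

(** The source point is no break, since breaks go to breaks; nor is its cell collapsed, since the
    value would then equal that at an endpoint, a break of the target. *)
Lemma cellular_nbreak (G1 G2 : graph) B1 B2 (phi : points R G1 -> points R G2)
    (f : cellT B1 -> option (cellT B2)) x c' :
  breaks B1 -> breaks B2 -> cellular phi f -> open_cell (val c') (phi x) ->
  exists2 c, open_cell (val c) x & f c = Some c'.
Proof.
move=> bB1 bB2 [B12 ff] c'x.
have nB2 : ~ B2 (phi x).
  by apply: open_cell_nbreak c'x; have [] := cellTP c' bB2.
have [|c cx] := @cellT_cover _ _ B1 x bB1; first by move/B12.
exists c => //; have [av Ba _] := cellTP c bB1; have [_ ab _ _] := av.
have [t [tc xE]] := cx.
have := ff c; case: (f c) => [c'' [p [q [H1 _ H3 _]]]|[y yP]].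
  congr Some; apply: (cellT_disj bB2 _ c'x).
  by exists (p * t + q); rewrite -H3 xE -H1//; lra.
exfalso; apply: nB2; rewrite xE (yP t) -?(yP (val c).1.2) ?lexx; [|lra..].
exact: B12.
Qed.

Lemma cellular_onto (G1 G2 : graph) B1 B2 (phi : points R G1 -> points R G2)
    (f : cellT B1 -> option (cellT B2)) c c' y :
  breaks B1 -> breaks B2 -> cellular phi f -> f c = Some c' ->
  open_cell (val c') y -> exists2 x, open_cell (val c) x & phi x = y.
Proof.
move=> bB1 bB2 [B12 ff] fc [s [sc' ->]].
have [_ ab' _ _] := let: And3 h _ _ := cellTP c' bB2 in h.
have := ff c; rewrite fc => -[p [q [H1 _ H3 H4]]].
have p0 : p != 0.
  apply/eqP => p0; move: H4; rewrite p0 normr0 mul0r; lra.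
have sE : p * ((s - q) / p) + q = s by field.
have tc : (val c).1.2 < (s - q) / p < (val c).2 by rewrite H3 sE.
exists (edge_pt (val c).1.1 ((s - q) / p)); first by exists ((s - q) / p).
by rewrite H1 ?sE//; lra.
Qed.

Lemma cellular_inj (G1 G2 : graph) B1 B2 (phi : points R G1 -> points R G2)
    (f : cellT B1 -> option (cellT B2)) c c' x y :
  breaks B1 -> breaks B2 -> cellular phi f -> f c = Some c' ->
  open_cell (val c) x -> open_cell (val c) y -> phi x = phi y -> x = y.
Proof.
move=> bB1 bB2 [B12 ff] fc [t [tc ->]] [u [uc ->]].
have [av _ _] := cellTP c' bB2; have [_ ab' _ _] := av.
have := ff c; rewrite fc => -[p [q [H1 _ H3 H4]]].
have p0 : p != 0.
  apply/eqP => p0; move: H4; rewrite p0 normr0 mul0r; lra.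
rewrite !H1; [|lra..].
move=> /edge_pt_inj[|_ /addIr/(mulfI p0)->//].
by apply: (avoids_itv av); rewrite -H3.
Qed.

Lemma esum_fiber (G1 G2 : graph) B1 B2 (phi : points R G1 -> points R G2)
    (f : cellT B1 -> option (cellT B2)) (h : points R G1 -> R)
    (v : cellT B1 -> R) (c' : cellT B2) y :
  breaks B1 -> breaks B2 -> cellular phi f ->
  (forall c, 0 <= v c) ->
  (forall c x, open_cell (val c) x -> h x = v c) ->
  open_cell (val c') y ->
  (\esum_(x in phi @^-1` [set y]) (h x)%:E)%E =
  (\sum_(c | f c == Some c') v c)%:E.
Proof.
move=> bB1 bB2 phif v0 hv c'y.
have /choice[k kP] c : exists x, f c = Some c' -> open_cell (val c) x /\ phi x = y.
  have [fc|nfc] := eqVneq (f c) (Some c'); last first.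
    by exists (edge_pt (val c).1.1 0) => fc; rewrite fc eqxx in nfc.
  by have [x cx <-] := cellular_onto bB1 bB2 phif fc c'y; exists x.
rewrite (@reindex_esum _ _ _ [set` [pred c | f c == Some c']] _ k); last first.
  split=> [c /= /eqP /kP[]//|c d /=|x /= xy].
    rewrite !inE => /eqP/kP[kc _] /eqP/kP[kd _] kcd.
    by apply: (cellT_disj bB1 kc); rewrite kcd.
  have [|c cx fc] := @cellular_nbreak _ _ _ _ phi f x c' bB1 bB2 phif.
    by rewrite xy.
  exists c; first by apply/eqP/fc.
  have [kc kcy] := kP c fc.
  by apply: (cellular_inj bB1 bB2 phif fc) => //; rewrite kcy xy.
rewrite esum_fset; last 2 first.
- exact: finite_finset.
- by move=> c; rewrite inE /= => /eqP/kP[kc _]; rewrite lee_fin (hv c).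
rewrite -(@bigfs _ _ _ _ (index_enum (cellT B1))); last 2 first.
- exact: index_enum_uniq.
- by move=> c _; rewrite mem_index_enum.
rewrite -sumEFin; apply: eq_bigr => c /eqP/kP[kc _].
by rewrite (hv c).
Qed.

Lemma cellular_comp (G1 G2 G3 : graph) B1 B2 B3
    (phi : points R G1 -> points R G2) (psi : points R G2 -> points R G3)
    (f : cellT B1 -> option (cellT B2)) (g : cellT B2 -> option (cellT B3)) :
  cellular phi f -> cellular psi g -> cellular (psi \o phi) (fun c => obind g (f c)).
Proof.
move=> [B12 ff] [B23 gg]; split=> [x /B12/B23//|c].
have := ff c; case: (f c) => [c' [p [q [H1 H2 H3 H4]]]|[y yP]] /=; last first.
  by exists (psi y) => t /yP /= ->.
have := gg c'; case: (g c') => [c'' [p' [q' [H5 H6 H7 H8]]]|[y yP]].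
  have E t : p' * p * t + (p' * q + q') = p' * (p * t + q) + q' by ring.
  exists (p' * p), (p' * q + q'); split.
  - by move=> t tc /=; rewrite E H1// H5// H2.
  - by move=> t tc; rewrite E; apply/H6/H2.
  - by move=> t; rewrite E H3 H7.
  - by rewrite normrM -mulrA H4 H8.
by exists y => t tc /=; rewrite H1// yP// H2.
Qed.

Lemma is_derive_affine (p q t : R) :
  is_derive t 1 (fun u : R => p * u + q) p.
Proof.
apply: trigger_derive.
by rewrite /= ?scaler0 ?add0r ?addr0 /GRing.scale /= ?mulr1 ?mulr0 ?addr0 ?add0r.
Qed.

Definition cell_len (G : graph) (l : edge G -> R) (c : cell R G) : R :=
  l c.1.1 * (c.2 - c.1.2).

Lemma cell_len_gt0 (G : graph) (l : edge G -> R) B (c : cellT B) :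
  breaks B -> (forall e, 0 < l e) -> 0 < cell_len l (val c).
Proof.
move=> bB l0; have [[_ ab _ _] _ _] := cellTP c bB.
by apply: mulr_gt0 => //; lra.
Qed.

(** In edge coordinates the derivative is [p], and [|p|] is the ratio of the coordinate lengths; the
    factor [l2 / l1] makes it the ratio of cell lengths. On a collapsed cell the derivative is 0, by
    the convention of [abs_deriv] if the value is a vertex. *)
Lemma abs_deriv_cell (G1 G2 : graph) (l1 : edge G1 -> R) (l2 : edge G2 -> R)
    B1 B2 (phi : points R G1 -> points R G2) (f : cellT B1 -> option (cellT B2))
    c x :
  breaks B1 -> breaks B2 -> (forall e, 0 < l1 e) ->
  cellular phi f -> open_cell (val c) x ->
  abs_deriv l1 l2 phi x =
    oslope (cell_len l1 \o val) (cell_len l2 \o val) f c.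
Proof.
move=> bB1 bB2 l10 [B12 ff] [t [tc ->]].
have [av _ _] := cellTP c bB1; have [_ ab _ _] := av.
have t01 := avoids_itv av tc.
have nt : \near t, (val c).1.2 < t < (val c).2.
  have : t \in `](val c).1.2, (val c).2[ by rewrite in_itv.
  move=> /near_in_itvoo; apply: filterS => u.
  by rewrite in_itv.
rewrite edge_ptE /abs_deriv /oslope -(edge_ptE _ t01).
have := ff c; case: (f c) => [c' [p [q [H1 H2 H3 H4]]]|[y yP]].
  have [av' _ _] := cellTP c' bB2.
  have int' u : (val c).1.2 < u < (val c).2 -> 0 < p * u + q < 1.
    by rewrite H3; exact: avoids_itv av'.
  rewrite H1; last lra.
  rewrite (edge_ptE _ (int' t tc)) /= derive1E.
  have -> : 'D_1 (fun u => edge_coord (val c').1.1 (phi (edge_pt (val c).1.1 u))) t = p.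
    have <- : 'D_1 (fun u => p * u + q) t = p.
      by have h := is_derive_affine p q t; exact: derive_val.
    apply: near_eq_derive; apply: filterS nt => u uc.
    by rewrite H1 ?(edge_ptE _ (int' u uc)) /= ?eqxx//; lra.
  rewrite /= /cell_len -H4; have := l10 (val c).1.1 => ?; field.
  by rewrite !gt_eqF//; lra.
rewrite yP; last lra.
case: y yP => // -[e' u] yP.
have -> : derive1 (fun u => edge_coord e' (phi (edge_pt (val c).1.1 u))) t = 0.
  rewrite derive1E -(derive_cst (val u : R) t 1); apply: near_eq_derive.
  apply: filterS nt => s sc.
  by rewrite yP/= ?eqxx//; lra.
by rewrite normr0 mul0r.
Qed.

(** * Cell structures adapted to one map or to two composable maps *)

Lemma common_cells2 (G1 G2 : graph) T1 T2 (phi : points R G1 -> points R G2) :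
  finite_set T1 -> finite_set T2 -> piecewise_linear phi ->
  exists B1 B2 (f : cellT B1 -> option (cellT B2)),
    [/\ breaks B1, breaks B2, T1 `<=` B1, T2 `<=` B2 & cellular phi f].
Proof.
move=> fT1 fT2 plphi.
have [S1 [fS1 TS1 S1P]] := refine_cells plphi fT1.
pose B2 := vertices R G2 `|` (T2 `|` phi @` S1).
have bB2 : breaks B2.
  split; last by move=> x; left.
  by rewrite !finite_setU; split; [exact: finite_vertices|split=> //; exact: finite_image].
have [|B1 [f [bB1 SB1 phif]]] := S1P B2 bB2; first by move=> x; right; right.
by exists B1, B2, f; split=> // [x /TS1/SB1//|x]; right; left.
Qed.

(** Forced cuts are pushed forward through [S1], then [psi] is subdivided, and the resulting [B2] is
    finally pulled back along [phi]. *)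
Lemma common_cells3 (G1 G2 G3 : graph) T1 T2 T3 (phi : points R G1 -> points R G2)
    (psi : points R G2 -> points R G3) :
  finite_set T1 -> finite_set T2 -> finite_set T3 ->
  piecewise_linear phi -> piecewise_linear psi ->
  exists B1 B2 B3 (f : cellT B1 -> option (cellT B2))
    (g : cellT B2 -> option (cellT B3)),
    [/\ [/\ breaks B1, breaks B2 & breaks B3],
        [/\ T1 `<=` B1, T2 `<=` B2 & T3 `<=` B3],
        cellular phi f & cellular psi g].
Proof.
move=> fT1 fT2 fT3 plphi plpsi.
have [S1 [fS1 TS1 S1P]] := refine_cells plphi fT1.
have fT2' : finite_set (T2 `|` phi @` S1).
  by rewrite finite_setU; split=> //; exact: finite_image.
have [B2 [B3 [g [bB2 bB3 TB2 TB3 psig]]]] := common_cells2 fT2' fT3 plpsi.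
have [|B1 [f [bB1 SB1 phif]]] := S1P B2 bB2; first by move=> x ?; apply: TB2; right.
exists B1, B2, B3, f, g; split=> //; split=> // x.
- by move=> /TS1/SB1.
- by move=> ?; apply: TB2; left.
Qed.

End cellular_maps.

(** * Integrals and essential suprema of functions constant on cells *)

Section cell_energies.
Variables (R : realType) (G : graph).
Local Open Scope ereal_scope.
Local Notation mu := (@lebesgue_measure R).

Lemma finite_set_measurable (A : set R) : finite_set A -> measurable A.
Proof.
move=> fA; apply: countable_measurable; first exact: measurable_set1.
exact: finite_set_countable.
Qed.

Lemma measurable_fun_finite (A : set R) (F : R -> \bar R) :
  finite_set A -> measurable_fun A F.
Proof.
by move=> fA _ Y _; apply: finite_set_measurable; exact: finite_setIl.
Qed.

(** Off the finitely many breaks, [F] along the edge is the step function [g]. *)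
Lemma integral_edge_cells B (F : points R G -> \bar R) (v : cellT B -> R) e :
  breaks B -> (forall x, 0 <= F x) -> (forall c, (0 <= v c)%R) ->
  (forall c x, open_cell (val c) x -> F x = (v c)%:E) ->
  \int[mu]_(t in `]0%R, 1%R[) F (edge_pt e t) =
  (\sum_(c | (val c).1.1 == e) ((val c).2 - (val c).1.2) * v c)%:E.
Proof.
move=> bB F0 v0 Fv; set D := [set` `]0%R, 1%R[].
have mD : measurable D by exact: measurable_itv.
have fN : finite_set (coords B e) by apply: finite_coords; case: bB.
pose I (c : cellT B) : set R := [set` `](val c).1.2, (val c).2[].
(* The factor discards the cells of other edges, whose intervals may overlap those of [e]. *)
pose k (c : cellT B) : R := (v c * ((val c).1.1 == e)%:R)%R.
have k0 c : (0 <= k c)%R by rewrite mulr_ge0.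
pose g t : \bar R := \sum_(c <- index_enum (cellT B)) (k c)%:E * (\1_(I c) t)%:E.
have mkI c E : measurable_fun E (fun t => (k c)%:E * (\1_(I c) t)%:E).
  apply: measurable_funTS; under eq_fun do rewrite -EFinM.
  apply/measurable_EFinP; apply: measurable_funM => //.
  by apply: measurable_indic; exact: measurable_itv.
have mg E : measurable_fun E g by exact: emeasurable_sum.
have kI0 c t : 0 <= (k c)%:E * (\1_(I c) t)%:E by rewrite -EFinM lee_fin mulr_ge0.
have Fg t : (D `\` coords B e) t -> F (edge_pt e t) = g t.
  move=> []; rewrite {1}/D/= in_itv/= => t01 nBt.
  have [|c [u [uc etE]]] := @cellT_cover _ _ B (edge_pt e t) bB.
    by move=> Bt; apply: nBt; split=> //; lra.
  have [ec ut] := edge_pt_inj t01 etE; subst u.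
  have ct : open_cell (val c) (edge_pt e t) by exists t; rewrite ec.
  rewrite (Fv c)// /g (bigD1_seq c)/= ?index_enum_uniq ?mem_index_enum//.
  rewrite big1_seq ?adde0.
    rewrite /k -ec eqxx mulr1 indicE mem_set ?mule1//.
  move=> d /andP[dc _]; rewrite /k; case: eqP => [de|_]; last by rewrite mulr0 mul0e.
  rewrite indicE memNset ?mule0// => dt.
  case/eqP: dc; apply: (cellT_disj bB (x := edge_pt e t)) => //.
  by exists t; rewrite de; split=> //; move: dt; rewrite /I/= in_itv.
transitivity (\int[mu]_(t in D) g t).
  apply: ge0_ae_eq_integral => //; last 3 first.
  - exact: mg.
  - by move=> t _; exact: sume_ge0.
  - exists (coords B e); split.
    + exact: finite_set_measurable.
    + exact/countable_lebesgue_measure0/finite_set_countable.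
    + move=> t /= /not_implyP[Dt Ft]; apply: contrapT => nB.
      by apply: Ft; exact: Fg.
  (* [F] is measurable because it is so on the finite set of breaks and agrees with [g]
     elsewhere. *)
  have fDN : finite_set (D `&` coords B e) by exact: finite_setIr.
  have mDN := finite_set_measurable fDN.
  rewrite -(setDUK (@subIsetl _ D (coords B e))).
  apply/(measurable_funU _ mDN (measurableD mD mDN)); split.
    exact: measurable_fun_finite.
  apply: eq_measurable_fun (mg _) => t; rewrite inE => -[Dt nt].
  by rewrite Fg//; split=> // Bt; apply: nt.
rewrite ge0_integral_sum//; last by move=> c; exact: mkI.
rewrite -sumEFin [RHS]big_mkcond/=; apply: eq_bigr => c _.
have mI : measurable (I c) by exact: measurable_itv.
rewrite ge0_integralZl_EFin//; last exact/measurable_EFinP/measurable_indic.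
rewrite integral_indic//.
have [[a0 ab b1 _] _ _] := cellTP c bB.
have -> : I c `&` D = I c.
  by apply/setIidl => t; rewrite /I /D/= !in_itv/= => ?; lra.
rewrite [X in _ * X](_ : _ = ((val c).2 - (val c).1.2)%:E).
  by rewrite -EFinM /k; case: ifP => _; rewrite ?mulr1 ?mulr0 ?mul0r// mulrC.
by have := lebesgue_measure_itv `](val c).1.2, (val c).2[; rewrite /= lte_fin ab.
Qed.

Lemma integral_graph_cells B (l : edge G -> R) (F : points R G -> \bar R)
    (v : cellT B -> R) :
  breaks B -> (forall x, 0 <= F x) -> (forall c, (0 <= v c)%R) ->
  (forall c x, open_cell (val c) x -> F x = (v c)%:E) ->
  integral_graph l F = (\sum_c cell_len l (val c) * v c)%:E.
Proof.
move=> bB F0 v0 Fv; rewrite /integral_graph.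
under eq_bigr do rewrite (integral_edge_cells _ bB F0 v0 Fv) -EFinM mulr_sumr.
rewrite sumEFin; congr EFin; under eq_bigr do rewrite big_mkcond.
rewrite exchange_big/=; apply: eq_bigr => c _.
rewrite (bigD1 (val c).1.1)//= eqxx big1 ?addr0 ?mulrA// => e.
by rewrite eq_sym => /negbTE ->.
Qed.

(** Cells have positive measure and breaks measure zero. The values [v] are extended reals to allow
    for infinite weight ratios, and [y] is nonnegative because the maximum over edges starts from
    0. *)
Lemma ess_sup_graph_le B (F : points R G -> \bar R) (v : cellT B -> \bar R) y :
  breaks B -> 0 <= y ->
  (forall c x, open_cell (val c) x -> F x = v c) ->
  ess_sup_graph F <= y <-> forall c, v c <= y.
Proof.
move=> bB y0 Fv; rewrite /ess_sup_graph; split.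
  move=> /bigmax_leP[_ /= Fy] c.
  have [[a0 ab b1 _] _ _] := cellTP c bB.
  have /ess_supP[A [mA A0 sA]] := Fy (val c).1.1 isT.
  rewrite leNgt; apply/negP => yv.
  pose I : set R := [set` `](val c).1.2, (val c).2[].
  have mI : measurable I by exact: measurable_itv.
  have IA : I `<=` A.
    move=> t; rewrite /I/= in_itv/= => tc; apply: sA => /=.
    by apply/negP; rewrite -ltNge (Fv c)//; exists t.
  have : mrestr mu (measurable_itv `]0%R, 1%R[) I <= 0.
    by rewrite -A0 le_measure// inE.
  rewrite /mrestr (_ : I `&` _ = I); last first.
    by apply/setIidl => t; rewrite /I/= !in_itv/= => ?; lra.
  rewrite /I lebesgue_measure_itv/= lte_fin ab -EFinD lee_fin; lra.
move=> vy; apply/bigmax_leP; split=> // e _; apply/ess_supP.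
have fN : finite_set (coords B e) by apply: finite_coords; case: bB.
have mN := finite_set_measurable fN.
have mD : measurable ([set` `]0%R, 1%R[] : set R) by exact: measurable_itv.
(* The complement of the open unit interval is null for the restricted measure. *)
exists (coords B e `|` ~` [set` `]0%R, 1%R[]); split.
- by apply: measurableU => //; exact: measurableC.
- change (mu ((coords B e `|` ~` [set` `]0%R, 1%R[]) `&` [set` `]0%R, 1%R[]) = 0).
  rewrite setIUl setICl setU0.
  apply/countable_lebesgue_measure0/finite_set_countable; exact: finite_setIl.
move=> t /= Fy; apply: contrapT => /not_orP[nB /contrapT]; rewrite in_itv/= => t01.
apply: Fy.
have [|c cx] := @cellT_cover _ _ B (edge_pt e t) bB.
  by move=> Bt; apply: nB; split=> //; lra.
by rewrite (Fv c).
Qed.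

Lemma ess_sup_graph_ge0 (F : points R G -> \bar R) : 0 <= ess_sup_graph F.
Proof. exact: bigmax_ge_id. Qed.

End cell_energies.

(** * Energies on cells *)

Section cellwise_weights.
Variables (R : realType) (G : graph).
Implicit Types (h : points R G -> R).

Definition cellwise B h (v : cellT B -> R) : Prop :=
  forall c (x : points R G), open_cell (val c) x -> h x = v c.

Lemma cellT_point B (c : cellT B) : breaks B -> exists x : points R G, open_cell (val c) x.
Proof.
move=> bB; have [av _ _] := cellTP c bB; have [t tc _] := mid_cell av.
by exists (edge_pt (val c).1.1 t), t.
Qed.

Lemma piecewise_constant_cellwise h :
  (forall x, 0 <= h x) -> piecewise_constant h ->
  exists2 T, finite_set T & forall B, breaks B -> T `<=` B ->
    exists2 v : cellT B -> R, (forall c, 0 <= v c) & cellwise h v.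
Proof.
move=> h0 /piecewise_constant_cst[T fT Tv]; exists T => // B bB TB.
have /choice[v vP] (c : cellT B) : exists v, forall x : points R G, open_cell (val c) x -> h x = v.
  by apply: Tv; apply: avoids_sub TB _; case: (cellTP c bB).
by exists v => // c; have [x cx] := cellT_point c bB; rewrite -(vP c x cx).
Qed.

Lemma piecewise_constant_finite_range h : piecewise_constant h ->
  finite_set (range h).
Proof.
move=> /piecewise_constant_cst[T fT Tv]; pose B := vertices R G `|` T.
have fB : finite_set B.
  by rewrite finite_setU; split=> //; exact: finite_vertices.
have bB : breaks B by split=> // x; left.
have /choice[v vP] (c : cellT B) : exists v, forall x : points R G, open_cell (val c) x -> h x = v.
  by apply: Tv; apply: (@avoids_sub _ _ T B) => [x|]; [right|case: (cellTP c bB)].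
apply: (@sub_finite_set _ _ (h @` B `|` range v)); last first.
  by rewrite finite_setU; split; [exact: finite_image|exact/finite_image/finite_finset].
move=> _ [x _ <-]; have [Bx|Bx] := pselect (B x); first by left; exists x.
by right; have [c cx] := cellT_cover bB Bx; exists c => //; rewrite (vP c x).
Qed.

End cellwise_weights.

Section energies_on_cells.
Variable R : realType.
Local Open Scope ereal_scope.

Lemma ess_sup_graph_fin (G : graph) B (F : points R G -> \bar R) (v : cellT B -> R) :
  breaks B -> (forall c, (0 <= v c)%R) ->
  (forall c x, open_cell (val c) x -> F x = (v c)%:E) ->
  exists r : R, [/\ (0 <= r)%R, ess_sup_graph F = r%:E & forall c, (v c <= r)%R].
Proof.
move=> bB v0 Fv.
have le y : 0 <= y -> ess_sup_graph F <= y <-> forall c, (v c)%:E <= y.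
  by move=> y0; exact: (ess_sup_graph_le bB y0 Fv).
have s0 := ess_sup_graph_ge0 F.
have sle : ess_sup_graph F <= (\sum_c v c)%:E.
  apply/le => [|c]; first by rewrite lee_fin sumr_ge0.
  by rewrite lee_fin (bigD1 c)//= lerDl sumr_ge0.
have sfin : ess_sup_graph F \is a fin_num.
  by rewrite ge0_fin_numE//; apply: le_lt_trans sle _; rewrite ltry.
exists (fine (ess_sup_graph F)); rewrite fineK//; split=> // [|c].
  exact: fine_ge0.
by rewrite -lee_fin fineK//; exact: (le _ s0).1.
Qed.

(** Clearing denominators stays valid for [w = 0]: the quotient is then 0 or infinite according to
    whether [n] vanishes. *)
Lemma lee_div_fin (n w r : R) : (0 <= n)%R -> (0 <= w)%R -> (0 <= r)%R ->
  (n%:E / w%:E <= r%:E) = (n <= r * w)%R.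
Proof.
move=> n0; rewrite le_eqVlt => /predU1P[<- r0|w0 r0].
  rewrite inve0 mulr0; move: n0; rewrite le_eqVlt => /predU1P[<-|n0].
    by rewrite mul0e lee_fin r0 lexx.
  by rewrite gt0_muley ?lte_fin// leNgt ltry/= leNgt n0.
by rewrite inver gt_eqF// -EFinM lee_fin ler_pdivrMr.
Qed.

Section one_map.
Variables (G1 G2 : graph) (B1 : set (points R G1)) (B2 : set (points R G2)).
Variables (phi : points R G1 -> points R G2) (f : cellT B1 -> option (cellT B2)).
Variables (l1 : edge G1 -> R) (l2 : edge G2 -> R) (h : points R G1 -> R) (w : cellT B1 -> R).
Hypotheses (bB1 : breaks B1) (bB2 : breaks B2) (phif : cellular phi f).
Hypotheses (l1_gt0 : forall e, (0 < l1 e)%R) (l2_gt0 : forall e, (0 < l2 e)%R).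
Hypotheses (hw : cellwise h w) (w_ge0 : forall c, (0 <= w c)%R).
Hypothesis h_ge0 : forall x, (0 <= h x)%R.

Lemma cell_len1_gt0 (c : cellT B1) : (0 < (cell_len l1 \o val) c)%R.
Proof. exact: cell_len_gt0. Qed.

Lemma cell_len2_gt0 (c : cellT B2) : (0 < (cell_len l2 \o val) c)%R.
Proof. exact: cell_len_gt0. Qed.

Lemma slope_ge0 (c : cellT B1) :
  (0 <= oslope (cell_len l1 \o val) (cell_len l2 \o val) f c)%R.
Proof. exact: oslope_ge0 cell_len1_gt0 cell_len2_gt0. Qed.

Lemma fiber_cells c y : open_cell (val c) y ->
  \esum_(x in phi @^-1` [set y]) (h x)%:E = (fiber_sum f w c)%:E.
Proof. exact: (esum_fiber bB1 bB2 phif w_ge0 hw). Qed.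

Lemma abs_deriv_ge0 x : (0 <= abs_deriv l1 l2 phi x)%R.
Proof.
rewrite /abs_deriv; case: x => // -[e t]; case: (phi _) => // -[e' t'].
by rewrite mulr_ge0// divr_ge0// ltW.
Qed.

Lemma fiber_deriv_cells c y : open_cell (val c) y ->
  \esum_(x in phi @^-1` [set y]) (abs_deriv l1 l2 phi x)%:E =
  (fiber_sum f (oslope (cell_len l1 \o val) (cell_len l2 \o val) f) c)%:E.
Proof.
apply: (esum_fiber bB1 bB2 phif slope_ge0) => c' x.
exact: abs_deriv_cell.
Qed.

Lemma integral_fiber_cells :
  integral_graph l2 (fun y => (\esum_(x in phi @^-1` [set y]) (h x)%:E) ^+ 2) =
  (\sum_c cell_len l2 (val c) * fiber_sum f w c ^+ 2)%:E.
Proof.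
apply: integral_graph_cells => //.
- by move=> x; rewrite sqre_ge0// esum_ge0.
- by move=> c; rewrite sqr_ge0.
- by move=> c x cx; rewrite (fiber_cells cx).
Qed.

Lemma integral_deriv_cells :
  integral_graph l1 (fun x => (h x * abs_deriv l1 l2 phi x)%:E) =
  (\sum_c fiber_sum f w c * cell_len l2 (val c))%:E.
Proof.
rewrite (@integral_graph_cells _ _ B1 l1 _ (fun c => w c *
    oslope (cell_len l1 \o val) (cell_len l2 \o val) f c)%R) //.
- by rewrite -(sum_fiber_sum_len f (cell_len l2 \o val) cell_len1_gt0).
- by move=> x; rewrite lee_fin mulr_ge0// abs_deriv_ge0.
- by move=> c; rewrite mulr_ge0// slope_ge0.
- move=> c x cx; rewrite (hw cx).
  by rewrite (abs_deriv_cell l2 bB1 bB2 l1_gt0 phif cx).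
Qed.

Lemma integral_deriv_sqr_cells :
  integral_graph l1 (fun x => (abs_deriv l1 l2 phi x ^+ 2)%:E) =
  (\sum_c cell_len l1 (val c) *
    oslope (cell_len l1 \o val) (cell_len l2 \o val) f c ^+ 2)%:E.
Proof.
apply: integral_graph_cells => //.
- by move=> x; rewrite lee_fin sqr_ge0.
- by move=> c; rewrite sqr_ge0.
- by move=> c x cx; rewrite (abs_deriv_cell l2 bB1 bB2 l1_gt0 phif cx).
Qed.

End one_map.
End energies_on_cells.

(** * The inequalities for maps *)

Section energy_inequalities.
Variable R : realType.
Local Open Scope ereal_scope.

Lemma weight_cellwise (W : weighted_graph R) :
  exists2 T, finite_set T & forall B, breaks B -> T `<=` B ->
    exists2 v : cellT B -> R, (forall c, (0 <= v c)%R) & cellwise (@weight R W) v.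
Proof.
exact: piecewise_constant_cellwise (@weight_ge0 R W) (@weight_pc R W).
Qed.

Lemma elastic_cell_gt0 (G : elastic_graph R) B : breaks B ->
  forall i : cellT B, (0 < (cell_len (@elastic R G) \o val) i)%R.
Proof. by move=> bB i; apply: cell_len_gt0 => //; exact: elastic_gt0. Qed.

Lemma elength_cell_gt0 (K : length_graph R) B : breaks B ->
  forall i : cellT B, (0 < (cell_len (@elength R K) \o val) i)%R.
Proof. by move=> bB i; apply: cell_len_gt0 => //; exact: elength_gt0. Qed.

Lemma WR_le_cells (W1 W2 : weighted_graph R) (phi : points R W1 -> points R W2)
    B1 B2 (f : cellT B1 -> option (cellT B2)) w1 w2 r :
  breaks B1 -> breaks B2 -> cellular phi f ->
  (forall c, (0 <= w1 c)%R) -> cellwise (@weight R W1) w1 ->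
  (forall c, (0 <= w2 c)%R) -> cellwise (@weight R W2) w2 -> (0 <= r)%R ->
  WR phi <= r%:E <-> forall c, (fiber_sum f w1 c <= r * w2 c)%R.
Proof.
move=> bB1 bB2 phif w10 w1P w20 w2P r0.
rewrite /WR (@ess_sup_graph_le _ _ B2 _ (fun c => (fiber_sum f w1 c)%:E / (w2 c)%:E)) //.
  by split=> H c; have := H c; rewrite lee_div_fin// fiber_sum_ge0.
move=> c y cy; rewrite /fiber_weight (fiber_cells bB1 bB2 phif w1P w10 cy).
by rewrite (w2P c y cy).
Qed.

Lemma WR_ge0 (W1 W2 : weighted_graph R) (phi : points R W1 -> points R W2) :
  0 <= WR phi.
Proof. exact: ess_sup_graph_ge0. Qed.

Lemma EL_cells (W : weighted_graph R) (G : elastic_graph R)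
    (c : points R W -> points R G) B1 B2 (f : cellT B1 -> option (cellT B2)) w :
  breaks B1 -> breaks B2 -> cellular c f ->
  (forall c, (0 <= w c)%R) -> cellwise (@weight R W) w ->
  EL c = (\sum_i cell_len (@elastic R G) (val i) * fiber_sum f w i ^+ 2)%:E.
Proof.
move=> bB1 bB2 cf w0 wP.
exact: (integral_fiber_cells (@elastic R G) bB1 bB2 cf wP w0).
Qed.

Lemma len_cells (W : weighted_graph R) (K : length_graph R)
    (c : points R W -> points R K) B1 B2 (f : cellT B1 -> option (cellT B2)) w :
  breaks B1 -> breaks B2 -> cellular c f ->
  (forall c, (0 <= w c)%R) -> cellwise (@weight R W) w ->
  len c = (\sum_i fiber_sum f w i * cell_len (@elength R K) (val i))%:E.
Proof.
move=> bB1 bB2 cf w0 wP.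
by apply: (integral_deriv_cells bB1 bB2 cf _ _ wP w0 (@weight_ge0 R W)) => //;
  exact: elength_gt0.
Qed.

Lemma Dir_cells (G : elastic_graph R) (K : length_graph R)
    (f : points R G -> points R K) B1 B2 (g : cellT B1 -> option (cellT B2)) :
  breaks B1 -> breaks B2 -> cellular f g ->
  Dir f = (\sum_i cell_len (@elastic R G) (val i) *
    oslope (cell_len (@elastic R G) \o val) (cell_len (@elength R K) \o val) g i ^+ 2)%:E.
Proof.
move=> bB1 bB2 fg; apply: integral_deriv_sqr_cells => //.
exact: elastic_gt0.
Qed.

Lemma Emb_cells (G1 G2 : elastic_graph R)
    (phi : points R G1 -> points R G2) B1 B2 (f : cellT B1 -> option (cellT B2)) :
  breaks B1 -> breaks B2 -> cellular phi f ->
  exists r : R, [/\ (0 <= r)%R, Emb phi = r%:E & forall c, (fiber_sum f (oslope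
    (cell_len (@elastic R G1) \o val) (cell_len (@elastic R G2) \o val) f) c <= r)%R].
Proof.
move=> bB1 bB2 phif; apply: ess_sup_graph_fin => // c.
  by apply/fiber_sum_ge0/slope_ge0 => //; exact: elastic_gt0.
by move=> y; apply: fiber_deriv_cells => //; exact: elastic_gt0.
Qed.

Lemma Emb_le_cells (G1 G2 : elastic_graph R)
    (phi : points R G1 -> points R G2) B1 B2 (f : cellT B1 -> option (cellT B2)) r :
  breaks B1 -> breaks B2 -> cellular phi f -> (0 <= r)%R ->
  (forall c, (fiber_sum f (oslope
    (cell_len (@elastic R G1) \o val) (cell_len (@elastic R G2) \o val) f) c <= r)%R) ->
  Emb phi <= r%:E.
Proof.
move=> bB1 bB2 phif r0 fr.
apply/(ess_sup_graph_le (B := B2) (v := fun c => (fiber_sum f (oslope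
    (cell_len (@elastic R G1) \o val) (cell_len (@elastic R G2) \o val) f) c)%:E)) => //.
by move=> c y; apply: fiber_deriv_cells => //; exact: elastic_gt0.
Qed.

Lemma Lip_cells (K1 K2 : length_graph R)
    (phi : points R K1 -> points R K2) B1 B2 (f : cellT B1 -> option (cellT B2)) :
  breaks B1 -> breaks B2 -> cellular phi f ->
  exists r : R, [/\ (0 <= r)%R, Lip phi = r%:E & forall c, (oslope
    (cell_len (@elength R K1) \o val) (cell_len (@elength R K2) \o val) f c <= r)%R].
Proof.
move=> bB1 bB2 phif; apply: ess_sup_graph_fin => // c.
  by apply: slope_ge0 => //; exact: elength_gt0.
move=> x cx; rewrite (abs_deriv_cell _ bB1 bB2 _ phif cx)//.
exact: elength_gt0.
Qed.

Lemma Lip_le_cells (K1 K2 : length_graph R)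
    (phi : points R K1 -> points R K2) B1 B2 (f : cellT B1 -> option (cellT B2)) r :
  breaks B1 -> breaks B2 -> cellular phi f -> (0 <= r)%R ->
  (forall c, (oslope
    (cell_len (@elength R K1) \o val) (cell_len (@elength R K2) \o val) f c <= r)%R) ->
  Lip phi <= r%:E.
Proof.
move=> bB1 bB2 phif r0 fr.
apply/(ess_sup_graph_le (B := B1) (v := fun c => (oslope
    (cell_len (@elength R K1) \o val) (cell_len (@elength R K2) \o val) f c)%:E)) => //.
move=> c x cx; rewrite (abs_deriv_cell _ bB1 bB2 _ phif cx)//.
exact: elength_gt0.
Qed.

Lemma ge0_fin_or_pinfty (x : \bar R) : 0 <= x ->
  x = +oo \/ exists2 r : R, (0 <= r)%R & x = r%:E.
Proof.
by case: x => [r||]//; rewrite ?lee_fin => r0; [right; exists r|left].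
Qed.

Lemma WR_comp_le (W1 W2 W3 : weighted_graph R) (phi : points R W1 -> points R W2)
    (psi : points R W2 -> points R W3) :
  piecewise_linear phi -> piecewise_linear psi ->
  WR (psi \o phi) <= mul_top (WR phi) (WR psi).
Proof.
move=> plphi plpsi.
have [T1 fT1 T1P] := weight_cellwise W1; have [T2 fT2 T2P] := weight_cellwise W2.
have [T3 fT3 T3P] := weight_cellwise W3.
have [B1 [B2 [B3 [f [g [[bB1 bB2 bB3] [/T1P-/(_ bB1)[w1 w10 w1P]
  /T2P-/(_ bB2)[w2 w20 w2P] /T3P-/(_ bB3)[w3 w30 w3P]] phif psig]]]]]] :=
  common_cells3 fT1 fT2 fT3 plphi plpsi.
have comph := cellular_comp phif psig.
rewrite /mul_top; case: eqVneq => [_|]; first by rewrite leey.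
have [->//|[r r0 rE] _] := ge0_fin_or_pinfty (WR_ge0 phi).
have /(WR_le_cells bB1 bB2 phif w10 w1P w20 w2P r0) rP : WR phi <= r%:E by rewrite rE.
rewrite rE; have [->|[s s0 sE]] := ge0_fin_or_pinfty (WR_ge0 psi).
  (* If [WR phi = 0], the right side is 0 even though [WR psi] is infinite; the composite then has
     ratio 0 because the push-forward of [w1] along [phi] already vanishes. *)
  move: r0; rewrite le_eqVlt => /predU1P[r0|r0]; last first.
    by rewrite gt0_muley ?lte_fin// leey.
  rewrite -r0 mul0e; apply/(WR_le_cells bB1 bB3 comph w10 w1P w30 w3P (lexx _)) => c.
  by apply: le_trans (fiber_sum_comp_le _ _ rP) _; rewrite -r0 !mul0r.
have /(WR_le_cells bB2 bB3 psig w20 w2P w30 w3P s0) sP : WR psi <= s%:E by rewrite sE.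
rewrite sE -EFinM.
apply/(WR_le_cells bB1 bB3 comph w10 w1P w30 w3P (mulr_ge0 r0 s0)) => c.
apply: le_trans (fiber_sum_comp_le _ _ rP) _.
by rewrite -mulrA; exact: ler_wpM2l.
Qed.

Lemma EL_comp_WR_le (W1 W2 : weighted_graph R) (G : elastic_graph R)
    (phi : points R W1 -> points R W2) (c : points R W2 -> points R G) :
  piecewise_linear phi -> piecewise_linear c ->
  EL (c \o phi) <= mul_top (WR phi ^+ 2) (EL c).
Proof.
move=> plphi plc.
have [T1 fT1 T1P] := weight_cellwise W1; have [T2 fT2 T2P] := weight_cellwise W2.
have [B1 [B2 [B3 [f [g [[bB1 bB2 bB3] [/T1P-/(_ bB1)[w1 w10 w1P]
  /T2P-/(_ bB2)[w2 w20 w2P] _] phif cg]]]]]] :=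
  common_cells3 fT1 fT2 (finite_set0 _) plphi plc.
rewrite /mul_top; case: eqVneq => [_|]; first by rewrite leey.
have [->//|[r r0 rE] _] := ge0_fin_or_pinfty (WR_ge0 phi).
have /(WR_le_cells bB1 bB2 phif w10 w1P w20 w2P r0) rP : WR phi <= r%:E by rewrite rE.
rewrite rE (EL_cells bB1 bB3 (cellular_comp phif cg) w10 w1P) (EL_cells bB2 bB3 cg w20 w2P).
rewrite -EFin_expe -EFinM lee_fin mulr_sumr; apply: ler_sum => i _.
rewrite [leRHS]mulrCA; apply: ler_wpM2l; first by rewrite ltW// cell_len_gt0//; exact: elastic_gt0.
rewrite -exprMn ler_sqr ?nnegrE ?mulr_ge0 ?fiber_sum_ge0//.
exact: fiber_sum_comp_le.
Qed.

Lemma len_comp_WR_le (W1 W2 : weighted_graph R) (K : length_graph R)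
    (phi : points R W1 -> points R W2) (f : points R W2 -> points R K) :
  piecewise_linear phi -> piecewise_linear f ->
  len (f \o phi) <= mul_top (WR phi) (len f).
Proof.
move=> plphi plc.
have [T1 fT1 T1P] := weight_cellwise W1; have [T2 fT2 T2P] := weight_cellwise W2.
have [B1 [B2 [B3 [g [h [[bB1 bB2 bB3] [/T1P-/(_ bB1)[w1 w10 w1P]
  /T2P-/(_ bB2)[w2 w20 w2P] _] phig fh]]]]]] :=
  common_cells3 fT1 fT2 (finite_set0 _) plphi plc.
rewrite /mul_top; case: eqVneq => [_|]; first by rewrite leey.
have [->//|[r r0 rE] _] := ge0_fin_or_pinfty (WR_ge0 phi).
have /(WR_le_cells bB1 bB2 phig w10 w1P w20 w2P r0) rP : WR phi <= r%:E by rewrite rE.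
rewrite rE (len_cells bB1 bB3 (cellular_comp phig fh) w10 w1P) (len_cells bB2 bB3 fh w20 w2P).
rewrite -EFinM lee_fin mulr_sumr; apply: ler_sum => i _.
rewrite [leRHS]mulrA; apply: ler_wpM2r; first by rewrite ltW// cell_len_gt0//; exact: elength_gt0.
exact: fiber_sum_comp_le.
Qed.

Lemma EL_comp_Emb_le (W : weighted_graph R) (G1 G2 : elastic_graph R)
    (c : points R W -> points R G1) (phi : points R G1 -> points R G2) :
  piecewise_linear c -> piecewise_linear phi ->
  EL (phi \o c) <= EL c * Emb phi.
Proof.
move=> plc plphi; have [T fT TP] := weight_cellwise W.
have [B1 [B2 [B3 [f [g [[bB1 bB2 bB3] [/TP-/(_ bB1)[w w0 wP] _ _] cf phig]]]]]] :=
  common_cells3 fT (finite_set0 _) (finite_set0 _) plc plphi.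
have [r [r0 -> rP]] := Emb_cells bB2 bB3 phig.
rewrite (EL_cells bB1 bB3 (cellular_comp cf phig) w0 wP) (EL_cells bB1 bB2 cf w0 wP).
rewrite -EFinM lee_fin.
exact: (sum_fiber_sum_sqr_comp_le f w (elastic_cell_gt0 bB2) (elastic_cell_gt0 bB3) r0 rP).
Qed.

Lemma len_comp_EL_Dir_le (W : weighted_graph R) (G : elastic_graph R)
    (K : length_graph R) (c : points R W -> points R G) (f : points R G -> points R K) :
  piecewise_linear c -> piecewise_linear f ->
  len (f \o c) ^+ 2 <= EL c * Dir f.
Proof.
move=> plc plf; have [T fT TP] := weight_cellwise W.
have [B1 [B2 [B3 [h [g [[bB1 bB2 bB3] [/TP-/(_ bB1)[w w0 wP] _ _] ch fg]]]]]] :=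
  common_cells3 fT (finite_set0 _) (finite_set0 _) plc plf.
rewrite (len_cells bB1 bB3 (cellular_comp ch fg) w0 wP) (EL_cells bB1 bB2 ch w0 wP).
rewrite (Dir_cells bB2 bB3 fg) -EFin_expe -EFinM lee_fin.
exact: (sum_fiber_sum_comp_sqr_le h g _ w (elastic_cell_gt0 bB2)).
Qed.

Lemma len_comp_Lip_le (W : weighted_graph R) (K1 K2 : length_graph R)
    (c : points R W -> points R K1) (phi : points R K1 -> points R K2) :
  piecewise_linear c -> piecewise_linear phi ->
  len (phi \o c) <= len c * Lip phi.
Proof.
move=> plc plphi; have [T fT TP] := weight_cellwise W.
have [B1 [B2 [B3 [f [g [[bB1 bB2 bB3] [/TP-/(_ bB1)[w w0 wP] _ _] cf phig]]]]]] :=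
  common_cells3 fT (finite_set0 _) (finite_set0 _) plc plphi.
have [r [r0 -> rP]] := Lip_cells bB2 bB3 phig.
rewrite (len_cells bB1 bB3 (cellular_comp cf phig) w0 wP) (len_cells bB1 bB2 cf w0 wP).
rewrite -EFinM lee_fin.
exact: (sum_fiber_sum_comp_le f (elength_cell_gt0 bB2) w0 rP).
Qed.

Lemma Emb_comp_le (G1 G2 G3 : elastic_graph R)
    (phi : points R G1 -> points R G2) (psi : points R G2 -> points R G3) :
  piecewise_linear phi -> piecewise_linear psi ->
  Emb (psi \o phi) <= Emb phi * Emb psi.
Proof.
move=> plphi plpsi.
have [B1 [B2 [B3 [f [g [[bB1 bB2 bB3] _ phif psig]]]]]] :=
  common_cells3 (finite_set0 _) (finite_set0 _) (finite_set0 _) plphi plpsi.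
have [r [r0 -> rP]] := Emb_cells bB1 bB2 phif.
have [s [s0 -> sP]] := Emb_cells bB2 bB3 psig.
rewrite -EFinM; apply: (Emb_le_cells bB1 bB3 (cellular_comp phif psig)) => [|c].
  exact: mulr_ge0.
apply: le_trans (ler_wpM2l r0 (sP c)).
exact: (fiber_oslope_comp_le g (elastic_cell_gt0 bB1) (elastic_cell_gt0 bB2) (elastic_cell_gt0 bB3) _ rP).
Qed.

Lemma Dir_comp_Emb_le (G1 G2 : elastic_graph R) (K : length_graph R)
    (phi : points R G1 -> points R G2) (f : points R G2 -> points R K) :
  piecewise_linear phi -> piecewise_linear f ->
  Dir (f \o phi) <= Emb phi * Dir f.
Proof.
move=> plphi plf.
have [B1 [B2 [B3 [h [g [[bB1 bB2 bB3] _ phih fg]]]]]] :=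
  common_cells3 (finite_set0 _) (finite_set0 _) (finite_set0 _) plphi plf.
have [r [r0 -> rP]] := Emb_cells bB1 bB2 phih.
rewrite (Dir_cells bB1 bB3 (cellular_comp phih fg)) (Dir_cells bB2 bB3 fg).
rewrite -EFinM lee_fin.
exact: (sum_oslope_sqr_comp_le g _ (elastic_cell_gt0 bB1) (elastic_cell_gt0 bB2) rP).
Qed.

Lemma Dir_comp_Lip_le (G : elastic_graph R) (K1 K2 : length_graph R)
    (f : points R G -> points R K1) (phi : points R K1 -> points R K2) :
  piecewise_linear f -> piecewise_linear phi ->
  Dir (phi \o f) <= Dir f * Lip phi ^+ 2.
Proof.
move=> plf plphi.
have [B1 [B2 [B3 [h [g [[bB1 bB2 bB3] _ fh phig]]]]]] :=
  common_cells3 (finite_set0 _) (finite_set0 _) (finite_set0 _) plf plphi.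
have [r [r0 -> rP]] := Lip_cells bB2 bB3 phig.
rewrite (Dir_cells bB1 bB3 (cellular_comp fh phig)) (Dir_cells bB1 bB2 fh).
rewrite -EFin_expe -EFinM lee_fin.
exact: (sum_oslope_sqr_comp_le_sqr h (elastic_cell_gt0 bB1) (elength_cell_gt0 bB2) (elength_cell_gt0 bB3) rP r0).
Qed.

Lemma Lip_comp_le (K1 K2 K3 : length_graph R)
    (phi : points R K1 -> points R K2) (psi : points R K2 -> points R K3) :
  piecewise_linear phi -> piecewise_linear psi ->
  Lip (psi \o phi) <= Lip phi * Lip psi.
Proof.
move=> plphi plpsi.
have [B1 [B2 [B3 [f [g [[bB1 bB2 bB3] _ phif psig]]]]]] :=
  common_cells3 (finite_set0 _) (finite_set0 _) (finite_set0 _) plphi plpsi.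
have [r [r0 -> rP]] := Lip_cells bB1 bB2 phif.
have [s [s0 -> sP]] := Lip_cells bB2 bB3 psig.
rewrite -EFinM; apply: (Lip_le_cells bB1 bB3 (cellular_comp phif psig)) => [|c].
  exact: mulr_ge0.
apply: le_trans (ler_wpM2r s0 (rP c)).
exact: (oslope_comp_le f (elength_cell_gt0 bB1) (elength_cell_gt0 bB2) _ sP s0).
Qed.

End energy_inequalities.

(** * Homotopy classes *)

Section homotopy_classes.
Variable R : realType.

Lemma marked_PL_comp (G1 G2 G3 : marked_graph) (phi : points R G1 -> points R G2)
    (psi : points R G2 -> points R G3) :
  marked_PL phi -> marked_PL psi -> marked_PL (psi \o phi).
Proof.
move=> [cphi plphi mphi] [cpsi plpsi mpsi]; split.
- by move=> x; apply: continuous_comp; [exact: cphi|exact: cpsi].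
- have [B1 [B2 [B3 [f [g [[bB1 _ bB3] _ phif psig]]]]]] :=
    common_cells3 (finite_set0 _) (finite_set0 _) (finite_set0 _) plphi plpsi.
  exact: cellular_piecewise_linear bB1 bB3 (cellular_comp phif psig).
- by move=> _ [x mx <-]; apply: mpsi; exists (phi x) => //; apply: mphi; exists x.
Qed.

Lemma homotopic_refl (G1 G2 : marked_graph) (f : points R G1 -> points R G2) :
  marked_PL f -> homotopic f f.
Proof.
move=> [cf _ mf]; exists (f \o fst); split=> //.
apply: continuous_subspaceT => x.
by apply: continuous_comp; [exact: cvg_fst|exact: cf].
Qed.

(** The homotopy is K(H(x, t), t); leaving t unchanged keeps it inside the strip where [K] is
    continuous. *)
Lemma homotopic_comp (G1 G2 G3 : marked_graph) (phi phi' : points R G1 -> points R G2)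
    (psi psi' : points R G2 -> points R G3) :
  homotopic phi phi' -> homotopic psi psi' -> homotopic (psi \o phi) (psi' \o phi').
Proof.
move=> [H [cH H0 H1 mH]] [K [cK K0 K1 mK]].
exists (fun p => K (H p, p.2)); split.
- apply/subspace_continuousP => x Ax.
  move/subspace_continuousP : cH => /(_ x Ax) cH.
  move/subspace_continuousP : cK => /(_ (H x, x.2) Ax) cK.
  apply: (cvg_comp _ _ _ cK).
  have HA : (fun p => (H p, p.2)) @ within [set p | 0 <= p.2 <= 1] (nbhs x) --> (H x, x.2).
    apply: (cvg_pair (G := nbhs (H x)) (H := nbhs x.2) cH).
    by case: x {Ax cH cK} => x1 x2; apply: cvg_within_filter; exact: cvg_snd.
  move=> W /HA; rewrite !nbhs_simpl /=.
  apply: filterS2 (withinT [set p | 0 <= p.2 <= 1] (nbhs_filter x)) => p.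
  by move=> pA; apply.
- by move=> x; rewrite H0 K0.
- by move=> x; rewrite H1 K1.
- move=> t t01; rewrite /is_marked => _ [x mx <-].
  by apply: (mK t t01); exists (H (x, t)) => //; apply: (mH t t01); exists x.
Qed.

Lemma homotopy_class_self (G1 G2 : marked_graph) (f : points R G1 -> points R G2) :
  marked_PL f -> homotopy_class f f.
Proof. by move=> mf; split=> //; exact: homotopic_refl. Qed.

Lemma homotopy_class_comp (G1 G2 G3 : marked_graph) (phi phi' : points R G1 -> points R G2)
    (psi psi' : points R G2 -> points R G3) :
  homotopy_class phi phi' -> homotopy_class psi psi' ->
  homotopy_class (psi \o phi) (psi' \o phi').
Proof.
by move=> [? ?] [? ?]; split; [exact: marked_PL_comp|exact: homotopic_comp].
Qed.

Local Open Scope ereal_scope.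

Lemma class_energy_le (G1 G2 : marked_graph) E (f g : points R G1 -> points R G2) :
  homotopy_class f g -> class_energy E f <= E g.
Proof. by move=> fg; apply: ge_ereal_inf; exists (E g) => //; exists g. Qed.

Lemma class_energy_ge0 (G1 G2 : marked_graph) E (f : points R G1 -> points R G2) :
  (forall g, 0 <= E g) -> 0 <= class_energy E f.
Proof. by move=> E0; apply: le_ereal_inf_tmp => _ [g _ <-]. Qed.

(* The bound passes to the infima since a ^ m * b ^ n is continuous in (a, b). *)
Lemma class_energy_mul_ge (G1 G2 G3 G4 : marked_graph) E E'
    (f : points R G1 -> points R G2) (g : points R G3 -> points R G4) m n z :
  (forall f, 0 <= E f) -> (forall g, 0 <= E' g) ->
  class_energy E f < +oo -> class_energy E' g < +oo ->
  (forall f' g', homotopy_class f f' -> homotopy_class g g' -> E f' < +oo ->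
    z <= E f' ^+ m * E' g' ^+ n) ->
  z <= class_energy E f ^+ m * class_energy E' g ^+ n.
Proof.
move=> E0 E'0.
have [->//|[a a0 fa] _] := ge0_fin_or_pinfty (class_energy_ge0 f E0).
have [->//|[b b0 gb] _] := ge0_fin_or_pinfty (class_energy_ge0 g E'0).
rewrite fa gb => H.
(* Representatives with energies below [a + e] and [b + e] bound [z] by [F e] for every positive
   [e]. *)
pose F (e : R) : R := ((a + e) ^+ m * (b + e) ^+ n)%R.
have zF e : (0 < e)%R -> z <= (F e)%:E.
  move=> e0.
  have /ereal_inf_lt[_ [f' ff' <-] f'a] : class_energy E f < (a + e)%:E.
    by rewrite fa lte_fin ltrDl.
  have /ereal_inf_lt[_ [g' gg' <-] g'b] : class_energy E' g < (b + e)%:E.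
    by rewrite gb lte_fin ltrDl.
  have [f'y|[a' a'0 f'E]] := ge0_fin_or_pinfty (E0 f'); first by rewrite f'y in f'a.
  have [g'y|[b' b'0 g'E]] := ge0_fin_or_pinfty (E'0 g'); first by rewrite g'y in g'b.
  have := H f' g' ff' gg'; rewrite f'E g'E ltry => /(_ isT) /le_trans; apply.
  rewrite -!EFin_expe -EFinM lee_fin.
  move: f'a g'b; rewrite f'E g'E !lte_fin => /ltW a'a /ltW b'b.
  by apply: ler_pM; rewrite ?exprn_ge0// lerXn2r ?nnegrE//; lra.
rewrite -!EFin_expe -EFinM.
have F0 : F 0%R = (a ^+ m * b ^+ n)%R by rewrite /F !addr0.
rewrite -F0 leNgt; apply/negP => Fz.
(* [z] may be infinite, so continuity of [F] at 0 is used against a real threshold [r]. *)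
have [r Fr rz] : exists2 r : R, (F 0 < r)%R & r%:E <= z.
  case: z Fz {H zF} => [r|_|//]; first by rewrite lte_fin => Fr; exists r.
  by exists (F 0%R + 1)%R; rewrite ?ltrDl ?leey.
have Xcont u k : {for 0%R, continuous (fun e : R => (u + e) ^+ k)%R}.
  apply: (@continuous_comp _ _ _ (fun e : R => u + e)%R (fun x : R => x ^+ k)%R).
    by apply: cvgD; [exact: cvg_cst|exact: cvg_id].
  exact: exprn_continuous.
have Fcont : {for 0%R, continuous F} by apply: continuousM; exact: Xcont.
have [e [e0 Fe]] : exists e : R, (0 < e)%R /\ (F e < r)%R.
  have h1 : \forall e \near 0^'+, (0 < e :> R)%R by exact: nbhs_right_gt.
  have h2 : \forall e \near 0^'+, (F e < r)%R.
    by apply: (@cvgr_lt _ _ _ _ F (F 0%R)) => //; exact: cvg_at_right_filter.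
  have := @filter_ex _ _ (at_right_proper_filter (0%R : R)) _ (filterI h1 h2).
  by case=> e [? ?]; exists e.
by have := le_trans rz (zF e e0); rewrite lee_fin leNgt Fe.
Qed.

End homotopy_classes.

(** * Finiteness of the energies and inequalities for their infima *)

Section energy_classes.
Variable R : realType.
Local Open Scope ereal_scope.

(** Composites of representatives represent the class of the composite. The inequality is required
    only for [f] of finite energy, where [mul_top] is the usual product. *)
Lemma class_energy_comp_le (G1 G2 G3 : marked_graph) E12 E23 E13
    (phi : points R G1 -> points R G2) (psi : points R G2 -> points R G3) m n :
  (forall f, 0 <= E12 f) -> (forall g, 0 <= E23 g) ->
  class_energy E12 phi < +oo -> class_energy E23 psi < +oo ->
  (forall f g, piecewise_linear f -> piecewise_linear g -> E12 f < +oo ->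
    E13 (g \o f) <= E12 f ^+ m * E23 g ^+ n) ->
  class_energy E13 (psi \o phi) <= class_energy E12 phi ^+ m * class_energy E23 psi ^+ n.
Proof.
move=> E120 E230 fphi fpsi H; apply: class_energy_mul_ge => // f g phif psig fy.
apply: le_trans (class_energy_le _ (homotopy_class_comp phif psig)) _.
by apply: H => //; [case: phif => -[]|case: psig => -[]].
Qed.

Lemma class_energy_lty (G1 G2 : marked_graph) E (f : points R G1 -> points R G2) :
  (forall f, piecewise_linear f -> E f < +oo) -> marked_PL f ->
  class_energy E f < +oo.
Proof.
move=> Efin mf; apply: le_lt_trans (class_energy_le E (homotopy_class_self mf)) _.
by apply: Efin; case: mf.
Qed.

Lemma integral_graph_ge0 (G : graph) (l : edge G -> R) (F : points R G -> \bar R) :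
  (forall e, (0 < l e)%R) -> (forall x, 0 <= F x) -> 0 <= integral_graph l F.
Proof.
move=> l0 F0; apply: sume_ge0 => e _; apply: mule_ge0; first by rewrite lee_fin ltW.
exact: integral_ge0.
Qed.

Lemma EL_ge0 (W : weighted_graph R) (G : elastic_graph R) (c : points R W -> points R G) :
  0 <= EL c.
Proof.
apply: integral_graph_ge0 => [|y]; first exact: elastic_gt0.
by rewrite sqre_ge0// esum_ge0// => x _; rewrite lee_fin weight_ge0.
Qed.

Lemma len_ge0 (W : weighted_graph R) (K : length_graph R) (f : points R W -> points R K) :
  0 <= len f.
Proof.
apply: integral_graph_ge0 => // x; rewrite lee_fin mulr_ge0 ?weight_ge0//.
by apply: abs_deriv_ge0 => //; exact: elength_gt0.
Qed.

Lemma Dir_ge0 (G : elastic_graph R) (K : length_graph R) (f : points R G -> points R K) :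
  0 <= Dir f.
Proof.
apply: integral_graph_ge0 => [|x]; first exact: elastic_gt0.
by rewrite lee_fin sqr_ge0.
Qed.

Lemma Emb_ge0 (G1 G2 : elastic_graph R) (phi : points R G1 -> points R G2) :
  0 <= Emb phi.
Proof. exact: ess_sup_graph_ge0. Qed.

Lemma Lip_ge0 (K1 K2 : length_graph R) (phi : points R K1 -> points R K2) :
  0 <= Lip phi.
Proof. exact: ess_sup_graph_ge0. Qed.

Lemma EL_lty (W : weighted_graph R) (G : elastic_graph R) (c : points R W -> points R G) :
  piecewise_linear c -> EL c < +oo.
Proof.
move=> plc; have [T fT TP] := weight_cellwise W.
have [B1 [B2 [f [bB1 bB2 /TP-/(_ bB1)[w w0 wP] _ cf]]]] := common_cells2 fT (finite_set0 _) plc.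
by rewrite (EL_cells bB1 bB2 cf w0 wP) ltry.
Qed.

Lemma len_lty (W : weighted_graph R) (K : length_graph R) (f : points R W -> points R K) :
  piecewise_linear f -> len f < +oo.
Proof.
move=> plf; have [T fT TP] := weight_cellwise W.
have [B1 [B2 [g [bB1 bB2 /TP-/(_ bB1)[w w0 wP] _ fg]]]] := common_cells2 fT (finite_set0 _) plf.
by rewrite (len_cells bB1 bB2 fg w0 wP) ltry.
Qed.

Lemma Dir_lty (G : elastic_graph R) (K : length_graph R) (f : points R G -> points R K) :
  piecewise_linear f -> Dir f < +oo.
Proof.
move=> plf.
have [B1 [B2 [g [bB1 bB2 _ _ fg]]]] := common_cells2 (finite_set0 _) (finite_set0 _) plf.
by rewrite (Dir_cells bB1 bB2 fg) ltry.
Qed.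

Lemma Emb_lty (G1 G2 : elastic_graph R) (phi : points R G1 -> points R G2) :
  piecewise_linear phi -> Emb phi < +oo.
Proof.
move=> plf.
have [B1 [B2 [g [bB1 bB2 _ _ fg]]]] := common_cells2 (finite_set0 _) (finite_set0 _) plf.
by have [r [_ -> _]] := Emb_cells bB1 bB2 fg; rewrite ltry.
Qed.

Lemma Lip_lty (K1 K2 : length_graph R) (phi : points R K1 -> points R K2) :
  piecewise_linear phi -> Lip phi < +oo.
Proof.
move=> plf.
have [B1 [B2 [g [bB1 bB2 _ _ fg]]]] := common_cells2 (finite_set0 _) (finite_set0 _) plf.
by have [r [_ -> _]] := Lip_cells bB1 bB2 fg; rewrite ltry.
Qed.

(* Weights take finitely many values, so small weight ratios vanish; hence an *)
(* infimum 0 of [WR] is attained, which is what [mul_top 0 +oo = 0] requires. *)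
Lemma WR_small_eq0 (W1 W2 : weighted_graph R) :
  exists2 k : R, (0 < k)%R & forall phi : points R W1 -> points R W2,
    piecewise_linear phi -> WR phi < k%:E -> WR phi = 0.
Proof.
have fw1 := piecewise_constant_finite_range (@weight_pc R W1).
have fw2 := piecewise_constant_finite_range (@weight_pc R W2).
(* [d] is the least positive weight of [W1], or 1 if there is none. *)
have [d d0 dP] : exists2 d : R, (0 < d)%R & forall x, (weight (w := W1) x < d)%R -> weight x = 0%R.
  have [[r [w1r r0]]|no] := pselect ((range (@weight R W1) `&` [set r | 0 < r]%R) !=set0).
    have [||d [_ d0] dmin] := @finite_set_min R (range (@weight R W1) `&` [set r | 0 < r]%R).
    - exact: finite_setIl.
    - by exists r.
    exists d => // x xd; apply/eqP; rewrite eq_le weight_ge0 andbT leNgt; apply/negP => x0.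
    have : (d <= weight x)%R by apply: dmin; split=> //; exists x.
    by rewrite leNgt xd.
  exists 1%R => // x _; apply/eqP; rewrite eq_le weight_ge0 andbT leNgt; apply/negP => x0.
  by apply: no; exists (weight x); split=> //; exists x.
have [M M0 MP] : exists2 M : R, (0 < M)%R & forall x, (weight (w := W2) x <= M)%R.
  (* Adjoining 1 makes the bound [M] positive. *)
  have [||M _ Mmax] := @finite_set_max R (range (@weight R W2) `|` [set 1%R]).
  - by rewrite finite_setU; split=> //; exact: finite_set1.
  - by exists 1%R; right.
  exists M => [|x]; last by apply: Mmax; left; exists x.
  by apply: lt_le_trans ltr01 _; apply: Mmax; right.
(* Below this threshold the weight gathered over a cell of [W2] is at most [r * M < d], so each of
   its nonnegative terms is less than [d], hence zero. *)
exists (d / M)%R => [|phi plphi]; first exact: divr_gt0.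
have [T1 fT1 T1P] := weight_cellwise W1; have [T2 fT2 T2P] := weight_cellwise W2.
have [B1 [B2 [f [bB1 bB2 /T1P-/(_ bB1)[w1 w10 w1P] /T2P-/(_ bB2)[w2 w20 w2P] phif]]]] :=
  common_cells2 fT1 fT2 plphi.
have [->|[r r0 rE]] := ge0_fin_or_pinfty (WR_ge0 phi); first by rewrite ltNge leey.
have /(WR_le_cells bB1 bB2 phif w10 w1P w20 w2P r0) rP : WR phi <= r%:E by rewrite rE.
rewrite rE lte_fin ltr_pdivlMr// => rM; rewrite -rE.
apply/eqP; rewrite eq_le WR_ge0 andbT.
apply/(WR_le_cells bB1 bB2 phif w10 w1P w20 w2P (lexx _)) => c2.
rewrite mul0r /fiber_sum big1// => c1 fc1.
have [x cx] := cellT_point c1 bB1; rewrite -(w1P c1 x cx); apply: dP.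
rewrite (w1P c1 x cx); apply: le_lt_trans rM.
have [y cy] := cellT_point c2 bB2.
apply: le_trans (ler_wpM2l r0 (MP y)); rewrite (w2P c2 y cy).
apply: le_trans (rP c2); rewrite /fiber_sum (bigD1 c1)//= lerDl.
exact: sumr_ge0.
Qed.

Lemma mul_top_fin (x y : \bar R) : x < +oo -> mul_top x y = x * y.
Proof. by rewrite /mul_top; case: eqVneq => // ->; rewrite ltxx. Qed.

Lemma class_WR_comp_le (W1 W2 W3 : weighted_graph R) (phi : points R W1 -> points R W2)
    (psi : points R W2 -> points R W3) :
  marked_PL phi -> marked_PL psi ->
  class_energy (@WR R W1 W3) (psi \o phi) <=
    mul_top (class_energy (@WR R W1 W2) phi) (class_energy (@WR R W2 W3) psi).
Proof.
move=> mphi mpsi.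
have [->|[a a0 aE]] := ge0_fin_or_pinfty (class_energy_ge0 phi (@WR_ge0 R W1 W2)).
  by rewrite /mul_top eqxx leey.
rewrite mul_top_fin; last by rewrite aE ltry.
have [psiy|[b b0 bE]] := ge0_fin_or_pinfty (class_energy_ge0 psi (@WR_ge0 R W2 W3)).
  move: a0; rewrite le_eqVlt => /predU1P[a0|a0]; last first.
    by rewrite aE psiy gt0_muley ?lte_fin// leey.
  (* The infimum for [phi] is 0 and that for [psi] infinite: some representative of [phi] has [WR]
     equal to 0, and composing it with [psi] itself gives 0. *)
  have [k k0 kP] := WR_small_eq0 W1 W2.
  have /ereal_inf_lt[_ [phi' phi'P <-] phi'k] : class_energy (@WR R W1 W2) phi < k%:E.
    by rewrite aE -a0 lte_fin.
  rewrite aE -a0 mul0e.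
  have plphi' : piecewise_linear phi' by case: phi'P => -[].
  apply: le_trans (class_energy_le _ (homotopy_class_comp phi'P (homotopy_class_self mpsi))) _.
  have plpsi : piecewise_linear psi by case: mpsi.
  apply: le_trans (WR_comp_le plphi' plpsi) _.
  by rewrite (kP _ plphi' phi'k) mul_top_fin ?ltry// mul0e.
apply: (class_energy_comp_le (m := 1) (n := 1)); rewrite ?aE ?bE ?ltry//.
- exact: WR_ge0.
- exact: WR_ge0.
- by move=> f g plf plg fy; rewrite -[leRHS]mul_top_fin//; exact: WR_comp_le.
Qed.

End energy_classes.

Local Open Scope ereal_scope.

Theorem proposition2p15 (R : realType)
    (W W1 W2 W3 : weighted_graph R)
    (G G1 G2 G3 : elastic_graph R)
    (K K1 K2 K3 : length_graph R) :
  (forall (phi : points R W1 -> points R W2) (psi : points R W2 -> points R W3),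
    marked_PL phi -> marked_PL psi ->
    WR (psi \o phi) <= mul_top (WR phi) (WR psi) /\
    class_energy (@WR R W1 W3) (psi \o phi) <=
      mul_top (class_energy (@WR R W1 W2) phi) (class_energy (@WR R W2 W3) psi))
  /\
  (forall (phi : points R W1 -> points R W2) (c : points R W2 -> points R G),
    marked_PL phi -> marked_PL c ->
    EL (c \o phi) <= mul_top (WR phi ^+ 2) (EL c) /\
    class_energy (@EL R W1 G) (c \o phi) <=
      mul_top (class_energy (@WR R W1 W2) phi ^+ 2)
              (class_energy (@EL R W2 G) c))
  /\
  (forall (phi : points R W1 -> points R W2) (f : points R W2 -> points R K),
    marked_PL phi -> marked_PL f ->
    len (f \o phi) <= mul_top (WR phi) (len f) /\
    class_energy (@len R W1 K) (f \o phi) <=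
      mul_top (class_energy (@WR R W1 W2) phi) (class_energy (@len R W2 K) f))
  /\
  (forall (c : points R W -> points R G1) (phi : points R G1 -> points R G2),
    marked_PL c -> marked_PL phi ->
    EL (phi \o c) <= EL c * Emb phi /\
    class_energy (@EL R W G2) (phi \o c) <=
      class_energy (@EL R W G1) c * class_energy (@Emb R G1 G2) phi)
  /\
  (forall (c : points R W -> points R G) (f : points R G -> points R K),
    marked_PL c -> marked_PL f ->
    len (f \o c) ^+ 2 <= EL c * Dir f /\
    class_energy (@len R W K) (f \o c) ^+ 2 <=
      class_energy (@EL R W G) c * class_energy (@Dir R G K) f)
  /\
  (forall (c : points R W -> points R K1) (phi : points R K1 -> points R K2),
    marked_PL c -> marked_PL phi ->
    len (phi \o c) <= len c * Lip phi /\
    class_energy (@len R W K2) (phi \o c) <=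
      class_energy (@len R W K1) c * class_energy (@Lip R K1 K2) phi)
  /\
  (forall (phi : points R G1 -> points R G2) (psi : points R G2 -> points R G3),
    marked_PL phi -> marked_PL psi ->
    Emb (psi \o phi) <= Emb phi * Emb psi /\
    class_energy (@Emb R G1 G3) (psi \o phi) <=
      class_energy (@Emb R G1 G2) phi * class_energy (@Emb R G2 G3) psi)
  /\
  (forall (phi : points R G1 -> points R G2) (f : points R G2 -> points R K),
    marked_PL phi -> marked_PL f ->
    Dir (f \o phi) <= Emb phi * Dir f /\
    class_energy (@Dir R G1 K) (f \o phi) <=
      class_energy (@Emb R G1 G2) phi * class_energy (@Dir R G2 K) f)
  /\
  (forall (f : points R G -> points R K1) (phi : points R K1 -> points R K2),
    marked_PL f -> marked_PL phi ->
    Dir (phi \o f) <= Dir f * Lip phi ^+ 2 /\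
    class_energy (@Dir R G K2) (phi \o f) <=
      class_energy (@Dir R G K1) f * class_energy (@Lip R K1 K2) phi ^+ 2)
  /\
  (forall (phi : points R K1 -> points R K2) (psi : points R K2 -> points R K3),
    marked_PL phi -> marked_PL psi ->
    Lip (psi \o phi) <= Lip phi * Lip psi /\
    class_energy (@Lip R K1 K3) (psi \o phi) <=
      class_energy (@Lip R K1 K2) phi * class_energy (@Lip R K2 K3) psi).
Proof.
split; last split; last split; last split; last split; last split; last split;
  last split; last split.
- move=> phi psi mphi mpsi; have [_ plphi _] := mphi; have [_ plpsi _] := mpsi.
  by split; [exact: WR_comp_le|exact: class_WR_comp_le].
- move=> phi c mphi mc; have [_ plphi _] := mphi; have [_ plc _] := mc.
  split; first exact: EL_comp_WR_le.
  have [->|[a a0 aE]] := ge0_fin_or_pinfty (class_energy_ge0 phi (@WR_ge0 R W1 W2)).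
    by rewrite /mul_top leey.
  rewrite mul_top_fin; last by rewrite aE -EFin_expe ltry.
  apply: (class_energy_comp_le (m := 2) (n := 1)).
  + exact: WR_ge0.
  + exact: EL_ge0.
  + by rewrite aE ltry.
  + exact: class_energy_lty (@EL_lty _ _ _) mc.
  + move=> f g plf plg fy; rewrite -[leRHS]mul_top_fin; first exact: EL_comp_WR_le.
    have [fE|[b _ ->]] := ge0_fin_or_pinfty (WR_ge0 f); first by rewrite fE in fy.
    by rewrite -EFin_expe ltry.
- move=> phi f mphi mf; have [_ plphi _] := mphi; have [_ plf _] := mf.
  split; first exact: len_comp_WR_le.
  have [->|[a a0 aE]] := ge0_fin_or_pinfty (class_energy_ge0 phi (@WR_ge0 R W1 W2)).
    by rewrite /mul_top leey.
  rewrite mul_top_fin; last by rewrite aE ltry.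
  apply: (class_energy_comp_le (m := 1) (n := 1)).
  + exact: WR_ge0.
  + exact: len_ge0.
  + by rewrite aE ltry.
  + exact: class_energy_lty (@len_lty _ _ _) mf.
  + by move=> g h plg plh gy; rewrite -[leRHS]mul_top_fin//; exact: len_comp_WR_le.
- move=> c phi mc mphi; have [_ plc _] := mc; have [_ plphi _] := mphi.
  split; first exact: EL_comp_Emb_le.
  apply: (class_energy_comp_le (m := 1) (n := 1)).
  + exact: EL_ge0.
  + exact: Emb_ge0.
  + exact: class_energy_lty (@EL_lty _ _ _) mc.
  + exact: class_energy_lty (@Emb_lty _ _ _) mphi.
  + by move=> f g plf plg _; exact: EL_comp_Emb_le.
- move=> c f mc mf; have [_ plc _] := mc; have [_ plf _] := mf.
  split; first exact: len_comp_EL_Dir_le.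
  (* The left side is the square of an infimum, so this form with a fixed bound is used; squaring is
     monotone on nonnegative values. *)
  apply: (class_energy_mul_ge (m := 1) (n := 1)).
  + exact: EL_ge0.
  + exact: Dir_ge0.
  + exact: class_energy_lty (@EL_lty _ _ _) mc.
  + exact: class_energy_lty (@Dir_lty _ _ _) mf.
  + move=> c' f' cc' ff' _.
    apply: (@le_trans _ _ (len (f' \o c') ^+ 2)); last first.
      by apply: len_comp_EL_Dir_le; [case: cc' => -[]|case: ff' => -[]].
    rewrite lee_sqr ?len_ge0//; last by apply: class_energy_ge0; exact: len_ge0.
    exact/class_energy_le/homotopy_class_comp.
- move=> c phi mc mphi; have [_ plc _] := mc; have [_ plphi _] := mphi.
  split; first exact: len_comp_Lip_le.
  apply: (class_energy_comp_le (m := 1) (n := 1)).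
  + exact: len_ge0.
  + exact: Lip_ge0.
  + exact: class_energy_lty (@len_lty _ _ _) mc.
  + exact: class_energy_lty (@Lip_lty _ _ _) mphi.
  + by move=> f g plf plg _; exact: len_comp_Lip_le.
- move=> phi psi mphi mpsi; have [_ plphi _] := mphi; have [_ plpsi _] := mpsi.
  split; first exact: Emb_comp_le.
  apply: (class_energy_comp_le (m := 1) (n := 1)).
  + exact: Emb_ge0.
  + exact: Emb_ge0.
  + exact: class_energy_lty (@Emb_lty _ _ _) mphi.
  + exact: class_energy_lty (@Emb_lty _ _ _) mpsi.
  + by move=> f g plf plg _; exact: Emb_comp_le.
- move=> phi f mphi mf; have [_ plphi _] := mphi; have [_ plf _] := mf.
  split; first exact: Dir_comp_Emb_le.
  apply: (class_energy_comp_le (m := 1) (n := 1)).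
  + exact: Emb_ge0.
  + exact: Dir_ge0.
  + exact: class_energy_lty (@Emb_lty _ _ _) mphi.
  + exact: class_energy_lty (@Dir_lty _ _ _) mf.
  + by move=> g h plg plh _; exact: Dir_comp_Emb_le.
- move=> f phi mf mphi; have [_ plf _] := mf; have [_ plphi _] := mphi.
  split; first exact: Dir_comp_Lip_le.
  apply: (class_energy_comp_le (m := 1) (n := 2)).
  + exact: Dir_ge0.
  + exact: Lip_ge0.
  + exact: class_energy_lty (@Dir_lty _ _ _) mf.
  + exact: class_energy_lty (@Lip_lty _ _ _) mphi.
  + by move=> g h plg plh _; exact: Dir_comp_Lip_le.
- move=> phi psi mphi mpsi; have [_ plphi _] := mphi; have [_ plpsi _] := mpsi.
  split; first exact: Lip_comp_le.
  apply: (class_energy_comp_le (m := 1) (n := 1)).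
  + exact: Lip_ge0.
  + exact: Lip_ge0.
  + exact: class_energy_lty (@Lip_lty _ _ _) mphi.
  + exact: class_energy_lty (@Lip_lty _ _ _) mpsi.
  + by move=> f g plf plg _; exact: Lip_comp_le.
Qed.
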